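(* Let $\mathbf{\Sigma}\in\mathbb{R}^{d\times d}$ be symmetric PSD with eigenvalues $\lambda_1\ge\dots\ge\lambda_d$, orthonormal eigenvectors $v_1,\dots,v_d$, $\mathrm{gap}=(\lambda_1-\lambda_2)/\lambda_1>0$, $(1+\frac{\mathrm{gap}}{150})\lambda_1\le\lambda\le(1+\frac{\mathrm{gap}}{100})\lambda_1$ and $\mathbf{B}=\lambda\mathbf{I}-\mathbf{\Sigma}$. Let $x_0=x/\|x\|_2$ with $x\sim\mathcal{N}(0,\mathbf{I})$, and suppose we have a randomized subroutine $\mathrm{solve}(\cdot)$ such that for every unit vector $y$, $$\mathbb{E}\|\mathrm{solve}(y)-\mathbf{B}^{-1}y\|_{\mathbf{B}}\le\frac1{3000\,\kappa(\mathbf{B}^{-1})\,d^{21}}\left\|\frac1{\lambda-y^\top\mathbf{\Sigma}y}y-\mathbf{B}^{-1}y\right\|_{\mathbf{B}},$$ where $\kappa(\mathbf{B}^{-1})=\lambda_1(\mathbf{B}^{-1})/\lambda_d(\mathbf{B}^{-1})$. Then the procedure $x_t=\mathrm{solve}(x_{t-1})/\|\mathrm{solve}(x_{t-1})\|_2$, after $T=O(\log d+\log\kappa(\mathbf{B}^{-1}))$ iterations, satisfies $G(x_T)\le\frac1{\sqrt{10}}$ with probability greater than $1-O(1/d^{10})$.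
   Context: $\lambda_i(\mathbf{B}^{-1})=1/(\lambda-\lambda_i)$. $\|y\|_{\mathbf{B}}=\sqrt{y^\top\mathbf{B}y}$; $\mathbf{P}_{v_1}$, $\mathbf{P}_{v_1^\perp}$ are orthogonal projections onto $\mathrm{span}(v_1)$ and its orthogonal complement; $G(y)=\|\mathbf{P}_{v_1^\perp}y\|_{\mathbf{B}}/\|\mathbf{P}_{v_1}y\|_{\mathbf{B}}$. *)

(* Defs.v *)
From HB Require Import structures.
From mathcomp Require Export all_boot all_order all_algebra.
From mathcomp Require Export all_classical all_reals all_analysis.

Set Implicit Arguments.
Unset Strict Implicit.
Unset Printing Implicit Defensive.

Import Order.TTheory GRing.Theory Num.Theory.
Import numFieldNormedType.Exports.

Local Open Scope classical_set_scope.
Local Open Scope ring_scope.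

(* Column vectors over R carry the product of the Borel sigma-algebras of the
   coordinates, which is the Borel sigma-algebra of R^n. *)
Definition measure_cV_display : measure_display.
Proof. exact: default_measure_display. Qed.

Section measurable_cV.
Context {R : realType}.
Variable n : nat.

Let coords : 'I_n -> 'cV[R]_n -> R := fun i x => x i 0.

Let cV_set0 : g_sigma_preimage coords set0.
Proof. exact: sigma_algebra0. Qed.

Let cV_setC A : g_sigma_preimage coords A -> g_sigma_preimage coords (~` A).
Proof. exact: sigma_algebraC. Qed.

Let cV_bigcup (F : (set 'cV[R]_n)^nat) :
  (forall i, g_sigma_preimage coords (F i)) ->
  g_sigma_preimage coords (\bigcup_i (F i)).
Proof. exact: sigma_algebra_bigcup. Qed.

HB.instance Definition _ :=
  @isMeasurable.Build measure_cV_display 'cV[R]_n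
    (g_sigma_preimage coords) cV_set0 cV_setC cV_bigcup.

End measurable_cV.

Section linear_algebra.
Context {R : realType} {d : nat}.
Implicit Types (A B Sigma : 'M[R]_d) (x y v : 'cV[R]_d).

Definition quad_form A y : R := (y^T *m A *m y) 0 0.

Definition norm2 y : R := Num.sqrt ((y^T *m y) 0 0).

Definition normB B y : R := Num.sqrt (quad_form B y).

Definition normalize y : 'cV[R]_d := (norm2 y)^-1 *: y.

Definition symmetric_psd A : Prop :=
  A^T = A /\ forall y, 0 <= quad_form A y.

Definition orthonormal_eigensystem Sigma (eig : 'I_d -> R)
    (v : 'I_d -> 'cV[R]_d) : Prop :=
  [/\ forall i j : 'I_d, (i <= j)%N -> eig j <= eig i,
      forall i j : 'I_d, ((v i)^T *m v j) 0 0 = (i == j)%:R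
    & forall i : 'I_d, Sigma *m v i = eig i *: v i].

(* For v <> 0, the orthogonal projection onto span(v) and the one onto its
   orthogonal complement. *)
Definition proj_span v : 'M[R]_d := (norm2 v ^+ 2)^-1 *: (v *m v^T).

Definition proj_perp v : 'M[R]_d := 1%:M - proj_span v.

(* The potential takes the value +oo when the component of y along v vanishes;
   with the convention x / 0 = 0 such a y would count as perfectly aligned. *)
Definition potential B v y : \bar R :=
  if normB B (proj_span v *m y) == 0 then +oo%E
  else (normB B (proj_perp v *m y) / normB B (proj_span v *m y))%:E.

Definition shifted (lambda : R) Sigma : 'M[R]_d := lambda%:M - Sigma.

End linear_algebra.

(* Positions of the eigenvalues lambda_1, lambda_2 and lambda_d, the dimension
   d being at least 2. *)
Definition idx_fst d (hd : (1 < d)%N) : 'I_d := Ordinal (ltnW hd).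
Definition idx_snd d (hd : (1 < d)%N) : 'I_d := Ordinal hd.
Definition idx_lst d (hd : (1 < d)%N) : 'I_d := rev_ord (idx_fst hd).

Section spectrum.
Context {R : realType} {d : nat}.
Variables (hd : (1 < d)%N) (eig : 'I_d -> R).

Definition rel_gap : R :=
  (eig (idx_fst hd) - eig (idx_snd hd)) / eig (idx_fst hd).

(* If lambda_1 >= ... >= lambda_d are the eigenvalues of Sigma, this is
   lambda_i(B^-1), the i-th largest eigenvalue of the inverse of
   B = lambda I - Sigma. *)
Definition eig_inv (lambda : R) (i : 'I_d) : R := (lambda - eig i)^-1.

Definition kappa_inv (lambda : R) : R :=
  eig_inv lambda (idx_fst hd) / eig_inv lambda (idx_lst hd).

End spectrum.

Section probability_notions.
Context {R : realType} (dO : measure_display) (Omega : measurableType dO).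
Variable P : probability Omega R.

Definition mutually_independent (I : eqType) (F : I -> set (set Omega)) :=
  forall (s : seq I) (E : I -> set Omega), uniq s ->
    (forall i, i \in s -> F i (E i)) ->
    P (\bigcap_(i in [set` s]) E i) = (\prod_(i <- s) P (E i))%E.

Definition sigma_of (dT : measure_display) (T : measurableType dT)
    (X : Omega -> T) : set (set Omega) :=
  preimage_set_system setT X measurable.

Definition has_law (dT : measure_display) (T : measurableType dT)
    (X : Omega -> T) (m : set T -> \bar R) : Prop :=
  measurable_fun setT X /\
  forall A : set T, measurable A -> P (X @^-1` A) = m A.

(* x ~ N(0, I): the coordinates are independent standard Gaussians. *)
Definition standard_gaussian_vector (d : nat) (x : Omega -> 'cV[R]_d) : Prop :=
  (forall i : 'I_d, has_law (fun w => x w i 0) (normal_prob 0 1)) /\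
  mutually_independent (fun i : 'I_d => sigma_of (fun w => x w i 0)).

(* The t-th call to the subroutine draws the seed U t: the seeds are i.i.d. with
   law mu, and independent of x. *)
Definition fresh_seeds (dX dS : measure_display) (X : measurableType dX)
    (S : measurableType dS) (mu : probability S R)
    (x : Omega -> X) (U : nat -> Omega -> S) : Prop :=
  (forall t, has_law (U t) mu) /\
  mutually_independent
    (fun k : option nat =>
       if k is Some t then sigma_of (U t) else sigma_of x).

End probability_notions.

Fixpoint solve_iter {R : realType} {d : nat} {S : Type}
    (solve : S -> 'cV[R]_d -> 'cV[R]_d) (seeds : nat -> S) (x : 'cV[R]_d)
    (t : nat) : 'cV[R]_d :=
  if t is t'.+1
  then normalize (solve (seeds t') (solve_iter solve seeds x t'))
  else normalize x.

(* Main.v *)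
From HB Require Import structures.
Require Import Defs.
From mathcomp Require Import measurable_realfun ring lra.

Set Implicit Arguments.
Unset Strict Implicit.
Unset Printing Implicit Defensive.

Import Order.TTheory GRing.Theory Num.Theory.
Import numFieldNormedType.Exports.

Local Open Scope classical_set_scope.
Local Open Scope ring_scope.

(** Write [c_i] for the coordinates of [y] in the eigenbasis and
    [b_i = lambda - lambda_i], so that [b_1 <= b_i / 100] for [i > 1] and
    [G(y)^2 = (sum_(i > 1) b_i c_i^2) / (b_1 c_1^2)].

    One step. The residual [|y / (y^T B y) - B^-1 y|_B] is at most
    [g |c_1| / sqrt b_1] whenever [G(y) <= g].  If the error of [solve] is at most
    [1 / (100 + 2 g)] times that quantity, then [G] decreases by a factor 4; by
    Markov's inequality this fails with probability at most [eps (100 + 2 g)],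
    where [eps = 1 / (3000 kappa d^21)].

    Start. Some entry of [v_1] is at least [1 / sqrt d] in absolute value;
    conditioning on the other entries of [x], the variable [v_1^T x] has density
    at most [sqrt d], so [|v_1^T x| >= d^-10 / sqrt d] up to probability
    [2 / d^10].  On that event [G(x_0) <= M(x)] with
    [M(x) = sqrt kappa d^11 (1 + |x|^2 / d)].

    Iteration. If [G(x_t) <= M(x) / 4^t], then the same holds at [t + 1] up to a
    probability bounded by the expectation of [eps (100 + 2 M(x) / 4^t)], because
    the seed of step [t] is independent of [(x, x_t)].  Since [M] has expectation
    [O(sqrt kappa d^11)], these probabilities form a geometric series plus
    [100 eps T], in total [O(d^-10)]. *)

Lemma eqW {R : realType} (x y : R) : x = y -> x <= y.
Proof. by move=> ->. Qed.

(** * Linear algebra in the eigenbasis *)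

Section eigenbasis.
Context {R : realType} {d : nat}.
Variable v : 'I_d -> 'cV[R]_d.
Implicit Types (g h k : R) (A : 'M[R]_d) (y z : 'cV[R]_d) (a : 'I_d -> R).

Definition coord i y : R := ((v i)^T *m y) 0 0.

Lemma coordD i y z : coord i (y + z) = coord i y + coord i z.
Proof. by rewrite /coord mulmxDr mxE. Qed.

Lemma coordZ i k y : coord i (k *: y) = k * coord i y.
Proof. by rewrite /coord -scalemxAr mxE. Qed.

Lemma coordE i y : coord i y = \sum_k v i k 0 * y k 0.
Proof. by rewrite /coord mxE; apply: eq_bigr => k _; rewrite mxE. Qed.

Lemma coord_sum (I : Type) (r : seq I) (P : pred I) i (F : I -> 'cV[R]_d) :
  coord i (\sum_(j <- r | P j) F j) = \sum_(j <- r | P j) coord i (F j).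
Proof. by rewrite /coord mulmx_sumr summxE. Qed.

Hypothesis ortho : forall i j, ((v i)^T *m v j) 0 0 = (i == j)%:R.

Lemma coord_basis i j : coord i (v j) = (i == j)%:R.
Proof. exact: ortho. Qed.

(** The square matrix [Q] with columns [v i] has [Q^T] as a left inverse, and a one-sided inverse of
    a square matrix is two-sided. *)
Lemma sum_outer_product : \sum_i v i *m (v i)^T = 1%:M.
Proof.
pose Q : 'M[R]_d := \matrix_(k, i) v i k 0.
have QTQ : Q^T *m Q = 1%:M.
  apply/matrixP => i j; rewrite mxE [RHS]mxE -ortho mxE.
  by apply: eq_bigr => k _; rewrite !mxE.
rewrite -(mulmx1C QTQ); apply/matrixP => k l.
rewrite summxE mxE; apply: eq_bigr => i _.
by rewrite mxE big_ord1 !mxE.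
Qed.

Lemma eigen_expansion y : y = \sum_i coord i y *: v i.
Proof.
rewrite -[LHS]mul1mx -sum_outer_product mulmx_suml; apply: eq_bigr => i _.
by rewrite -mulmxA [(v i)^T *m y]mx11_scalar mul_mx_scalar.
Qed.

Lemma coord_eigen A a i y : (forall j, A *m v j = a j *: v j) ->
  coord i (A *m y) = a i * coord i y.
Proof.
move=> Av; rewrite {1}(eigen_expansion y) mulmx_sumr coord_sum.
rewrite (bigD1 i)//= -scalemxAr Av !coordZ coord_basis eqxx mulr1 mulrC.
rewrite big1 ?addr0// => j ji; rewrite -scalemxAr Av !coordZ coord_basis.
by rewrite eq_sym (negbTE ji) !mulr0.
Qed.

Lemma dot_coord y z : (y^T *m z) 0 0 = \sum_i coord i y * coord i z.
Proof.
rewrite {1}(eigen_expansion z) mulmx_sumr summxE; apply: eq_bigr => i _.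
rewrite -scalemxAr mxE mulrC; congr (_ * _).
by rewrite /coord !mxE; apply: eq_bigr => k _; rewrite !mxE mulrC.
Qed.

Lemma sqr_norm2E y : norm2 y ^+ 2 = \sum_i coord i y ^+ 2.
Proof.
have E : (y^T *m y) 0 0 = \sum_i coord i y ^+ 2.
  by rewrite dot_coord; apply: eq_bigr => i _; rewrite expr2.
by rewrite /norm2 sqr_sqrtr E// sumr_ge0// => i _; exact: sqr_ge0.
Qed.

Lemma quad_form_eigen A a y : (forall j, A *m v j = a j *: v j) ->
  quad_form A y = \sum_i a i * coord i y ^+ 2.
Proof.
move=> Av; rewrite /quad_form -mulmxA dot_coord; apply: eq_bigr => i _.
by rewrite (coord_eigen _ _ Av) expr2 mulrCA.
Qed.

(** [A] is invertible because the spectral sum with reciprocal eigenvalues is an explicit right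
    inverse. *)
Lemma invmx_eigen A a i : (forall j, A *m v j = a j *: v j) ->
  (forall j, a j != 0) -> invmx A *m v i = (a i)^-1 *: v i.
Proof.
move=> Av a0; have uA : A \in unitmx.
  apply: (proj1 (@mulmx1_unit _ _ A (\sum_j (a j)^-1 *: (v j *m (v j)^T)) _)).
  rewrite mulmx_sumr -sum_outer_product; apply: eq_bigr => j _.
  by rewrite -scalemxAr mulmxA Av -scalemxAl scalerA mulVf// scale1r.
by rewrite -[v i in RHS](mulKmx uA) Av -scalemxAr scalerA mulVf// scale1r.
Qed.

Lemma norm2_eigen i : norm2 (v i) = 1.
Proof. by rewrite /norm2 ortho eqxx sqrtr1. Qed.

Lemma coord_proj_span i j y :
  coord j (proj_span (v i) *m y) = (j == i)%:R * coord j y.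
Proof.
apply: (@coord_eigen _ (fun j => (j == i)%:R)) => {}j.
rewrite /proj_span norm2_eigen expr1n invr1 scale1r -mulmxA.
rewrite [(v i)^T *m v j]mx11_scalar ortho mul_mx_scalar.
by rewrite eq_sym; case: eqP => [->//|]; rewrite !scale0r.
Qed.

Lemma coord_proj_perp i j y :
  coord j (proj_perp (v i) *m y) = (j != i)%:R * coord j y.
Proof.
rewrite /proj_perp mulmxBl mul1mx coordD -scaleN1r coordZ coord_proj_span.
by case: eqP => _ /=; rewrite ?mul1r ?mul0r ?mulN1r ?subrr// oppr0 addr0 ?mul1r.
Qed.

Variables (A : 'M[R]_d) (a : 'I_d -> R) (i0 : 'I_d).
Hypothesis Av : forall j, A *m v j = a j *: v j.
Hypothesis a_gt0 : forall j, 0 < a j.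

(** The squared [A]-norm of the component of [y] orthogonal to [v i0], that is, the numerator of
    [G(y)^2]. *)
Definition perp_form y : R := \sum_(j | j != i0) a j * coord j y ^+ 2.

Lemma perp_form_ge0 y : 0 <= perp_form y.
Proof. by apply: sumr_ge0 => j _; rewrite mulr_ge0 ?sqr_ge0// ltW. Qed.

Lemma quad_formD1 y :
  quad_form A y = a i0 * coord i0 y ^+ 2 + perp_form y.
Proof. by rewrite (quad_form_eigen _ Av) (bigD1 i0). Qed.

Lemma sqr_normB y : normB A y ^+ 2 = quad_form A y.
Proof.
rewrite /normB sqr_sqrtr// quad_formD1 addr_ge0 ?perp_form_ge0//.
by rewrite mulr_ge0 ?sqr_ge0// ltW.
Qed.

Lemma normB_proj_span y :
  normB A (proj_span (v i0) *m y) = Num.sqrt (a i0 * coord i0 y ^+ 2).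
Proof.
rewrite /normB quad_formD1 coord_proj_span eqxx mul1r /perp_form big1 ?addr0//.
by move=> j /negbTE ji; rewrite coord_proj_span ji mul0r expr0n mulr0.
Qed.

Lemma normB_proj_perp y :
  normB A (proj_perp (v i0) *m y) = Num.sqrt (perp_form y).
Proof.
rewrite /normB quad_formD1 coord_proj_perp eqxx mul0r expr0n mulr0 add0r.
congr Num.sqrt; apply: eq_bigr => j ji.
by rewrite coord_proj_perp ji mul1r.
Qed.

(** For [0 <= g] this is [G(y) <= g], squared and cleared of denominators; the first conjunct
    excludes the points where the potential is [+oo]. *)
Definition aligned g y : bool :=
  (coord i0 y != 0) && (perp_form y <= g ^+ 2 * (a i0 * coord i0 y ^+ 2)).

Lemma potential_le g y : 0 <= g ->
  (potential A (v i0) y <= g%:E)%E = aligned g y.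
Proof.
move=> g0; rewrite /potential /aligned normB_proj_span normB_proj_perp.
have [->|c0] /= := eqVneq (coord i0 y) 0.
  by rewrite expr0n mulr0 sqrtr0 eqxx.
have p0 : 0 < a i0 * coord i0 y ^+ 2 by rewrite mulr_gt0 ?exprn_even_gt0.
rewrite gt_eqF ?sqrtr_gt0// lee_fin ler_pdivrMr ?sqrtr_gt0//.
rewrite -[g in LHS]ger0_norm// -sqrtr_sqr -sqrtrM ?sqr_ge0//.
by rewrite ler_sqrt// mulr_ge0 ?sqr_ge0// ltW.
Qed.

Lemma alignedZ k g y : k != 0 -> aligned g (k *: y) = aligned g y.
Proof.
move=> k0; have k2 : 0 < k ^+ 2 by rewrite exprn_even_gt0.
rewrite /aligned coordZ mulf_eq0 negb_or k0 /=; congr (_ && _).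
have -> : perp_form (k *: y) = k ^+ 2 * perp_form y.
  rewrite /perp_form mulr_sumr; apply: eq_bigr => j _.
  by rewrite coordZ exprMn mulrCA.
rewrite exprMn (_ : _ * (_ * _) = k ^+ 2 * (g ^+ 2 * (a i0 * coord i0 y ^+ 2))).
  by rewrite ler_pM2l.
by ring.
Qed.

Lemma aligned_le g h y : 0 <= g -> g <= h -> aligned g y -> aligned h y.
Proof.
move=> g0 gh /andP[c0 le]; rewrite /aligned c0 (le_trans le)//=.
rewrite ler_wpM2r 1?mulr_ge0 ?sqr_ge0 ?(ltW (a_gt0 _))//.
by rewrite ler_sqr ?nnegrE// (le_trans g0).
Qed.

Lemma aligned_normalize g y : aligned g y -> aligned g (normalize y).
Proof.
move=> al; rewrite /normalize alignedZ// invr_eq0.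
apply/eqP => y0; have := sqr_norm2E y; rewrite y0 expr0n /= => /esym/eqP.
rewrite psumr_eq0 => [|j _]; last exact: sqr_ge0.
move=> /allP/(_ i0); rewrite mem_index_enum sqrf_eq0 => /(_ isT)/implyP/(_ isT).
by case/andP: al => /negbTE->.
Qed.

(** Since [0^-1 = 0], the vector [normalize 0] is [0]. Alignment rules this case out, so that an
    estimate for unit vectors applies to an aligned iterate. *)
Lemma norm2_aligned_normalize g y :
  aligned g (normalize y) -> norm2 (normalize y) = 1.
Proof.
case/andP; rewrite {1}/normalize coordZ mulf_eq0 negb_or invr_eq0 => /andP[n0 _] _.
have n_ge0 : 0 <= norm2 (normalize y) by exact: sqrtr_ge0.
apply/eqP; rewrite -(@eqrXn2 _ 2)// expr1n sqr_norm2E.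
under eq_bigr do rewrite coordZ exprMn.
by rewrite -mulr_sumr -sqr_norm2E exprVn mulVf// sqrf_eq0.
Qed.

(* The scalar [(y^T A y)^-1] minimises the residual over all multiples of [y],
   so it does at least as well as the scalar [(a i0)^-1], which cancels the
   component along [v i0]. *)
Lemma residual_le g y : (forall j, a i0 <= a j) -> norm2 y = 1 -> 0 <= g ->
  aligned g y ->
  normB A ((quad_form A y)^-1 *: y - invmx A *m y)
    <= g * (`|coord i0 y| / Num.sqrt (a i0)).
Proof.
move=> a_min y1 g0 /andP[c0 al].
have a0 j : a j != 0 by rewrite gt_eqF.
have iAv j : invmx A *m v j = (a j)^-1 *: v j by exact: invmx_eigen.
set q := quad_form A y.
have q0 : 0 < q.
  rewrite /q quad_formD1 ltr_pwDl ?perp_form_ge0// mulr_gt0//.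
  by rewrite exprn_even_gt0.
(* The unit norm of [y] turns the cross term into [- 2 * s]; the resulting parabola in [s] has its
   vertex at [q^-1]. *)
have form s : quad_form A (s *: y - invmx A *m y) =
    s ^+ 2 * q - 2 * s + \sum_i (a i)^-1 * coord i y ^+ 2.
  rewrite /q !(quad_form_eigen _ Av) mulr_sumr.
  have -> : 2 * s = \sum_i 2 * s * coord i y ^+ 2.
    by rewrite -mulr_sumr -sqr_norm2E y1 expr1n mulr1.
  rewrite -sumrB -big_split /=; apply: eq_bigr => i _.
  rewrite coordD coordZ -scaleN1r coordZ (coord_eigen _ _ iAv).
  by field.
have opt : quad_form A (q^-1 *: y - invmx A *m y) <=
           quad_form A ((a i0)^-1 *: y - invmx A *m y).
  rewrite !form lerD2r -subr_ge0.
  have -> : (a i0)^-1 ^+ 2 * q - 2 * (a i0)^-1 - (q^-1 ^+ 2 * q - 2 * q^-1)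
     = q * ((a i0)^-1 - q^-1) ^+ 2.
    by field; rewrite a0 gt_eqF.
  by rewrite mulr_ge0 ?sqr_ge0// ltW.
(* The coordinate along [v i0] vanishes; the others are those of [y] scaled by
   [(a i0)^-1 - (a j)^-1], which lies between [0] and [(a i0)^-1]. *)
have bound : quad_form A ((a i0)^-1 *: y - invmx A *m y) <=
    (a i0)^-1 ^+ 2 * perp_form y.
  rewrite quad_formD1 coordD coordZ -scaleN1r coordZ (coord_eigen _ _ iAv).
  rewrite mulN1r subrr expr0n mulr0 add0r /perp_form mulr_sumr.
  apply: ler_sum => j _.
  rewrite coordD coordZ coordZ (coord_eigen _ _ iAv) mulN1r -mulrBl exprMn.
  rewrite mulrCA ler_wpM2r 1?mulr_ge0 ?sqr_ge0 ?(ltW (a_gt0 _))//.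
  have h1 : (a j)^-1 <= (a i0)^-1 by rewrite lef_pV2// posrE.
  have h2 : 0 < (a j)^-1 by rewrite invr_gt0.
  by rewrite ler_sqr ?nnegrE; lra.
rewrite -ler_sqr ?nnegrE ?sqrtr_ge0// ?mulr_ge0 ?invr_ge0 ?sqrtr_ge0//.
rewrite sqr_normB (le_trans opt)// (le_trans bound)//.
rewrite !exprMn exprVn real_normK ?num_real// exprVn sqr_sqrtr ?(ltW (a_gt0 _))//.
rewrite mulrC ler_pdivrMr ?exprn_gt0// (le_trans al)//.
rewrite (_ : _ * _ * a i0 ^+ 2 = g ^+ 2 * (a i0 * coord i0 y ^+ 2))//.
by field.
Qed.

(** Exact inversion divides [G] by at least 100, because of the gap in [a]. The error [e] at most
    halves the leading coordinate, by [2 * (k * g) <= 1]. By [100 * k <= 1], its orthogonal part is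
    at most [g / 100] times the [A]-norm of the exact leading component. *)
Lemma aligned_contraction g k y e : 0 < g -> 0 <= k -> 100 * k <= 1 ->
  2 * (k * g) <= 1 -> (forall j, j != i0 -> 100 * a i0 <= a j) ->
  aligned g y ->
  normB A e <= k * (g * (`|coord i0 y| / Num.sqrt (a i0))) ->
  aligned (g / 4) (invmx A *m y + e).
Proof.
move=> g0 k0 k1 kg a_gap /andP[c0 al] eA.
have a0 j : a j != 0 by rewrite gt_eqF.
have iAv j : invmx A *m v j = (a j)^-1 *: v j by exact: invmx_eigen.
have a1 := a_gt0 i0.
set c := coord i0 y in c0 al eA *.
have c2 : 0 < c ^+ 2 by rewrite exprn_even_gt0.
have {}eA : quad_form A e <= (k * g) ^+ 2 * (c ^+ 2 / a i0).
  rewrite -sqr_normB (le_trans (lerXn2r _ _ _ eA))// ?nnegrE ?sqrtr_ge0//.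
    by rewrite !mulr_ge0 ?invr_ge0 ?sqrtr_ge0// ltW.
  rewrite mulrA exprMn [X in _ * X]exprMn real_normK ?num_real// exprVn.
  by rewrite sqr_sqrtr ?(ltW a1).
have e1 : coord i0 e ^+ 2 <= (k * g) ^+ 2 * (c / a i0) ^+ 2.
  have : a i0 * coord i0 e ^+ 2 <= (k * g) ^+ 2 * (c ^+ 2 / a i0).
    by rewrite (le_trans _ eA)// quad_formD1 lerDl perp_form_ge0.
  rewrite mulrC -ler_pdivlMr// => /le_trans; apply.
  by apply/eqW; field.
have e2 : perp_form e <= (k * g) ^+ 2 * (c ^+ 2 / a i0).
  by rewrite (le_trans _ eA)// quad_formD1 lerDr mulr_ge0 ?sqr_ge0// ltW.
have ce : `|coord i0 e| <= `|c / a i0| / 2.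
  rewrite -ler_sqr ?nnegrE ?mulr_ge0// exprMn !real_normK ?num_real//.
  rewrite (le_trans e1)// mulrC ler_wpM2l ?sqr_ge0//.
  by rewrite ler_sqr ?nnegrE ?mulr_ge0 ?(ltW g0)//; lra.
have lead : c ^+ 2 / a i0 / 4 <= a i0 * coord i0 (invmx A *m y + e) ^+ 2.
  rewrite coordD (coord_eigen _ _ iAv) -/c [_^-1 * c]mulrC.
  have : `|c / a i0| / 2 <= `|c / a i0 + coord i0 e|.
    have := lerB_normD (c / a i0) (coord i0 e); lra.
  rewrite -ler_sqr ?nnegrE ?mulr_ge0// exprMn !real_normK ?num_real//.
  rewrite -(ler_pM2l a1) => /(le_trans _); apply.
  by apply/eqW; field.
have perp : perp_form (invmx A *m y + e) <=
    2 * ((100 * a i0) ^-1 ^+ 2 * perp_form y) + 2 * perp_form e.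
  rewrite /perp_form !mulr_sumr -big_split /=; apply: ler_sum => j ji.
  rewrite coordD (coord_eigen _ _ iAv).
  set cj := coord j y; set ej := coord j e.
  have h : a j * ((a j)^-1 * cj + ej) ^+ 2 <=
      2 * ((a j)^-1 ^+ 2 * (a j * cj ^+ 2)) + 2 * (a j * ej ^+ 2).
    (* The parallelogram identity for the exact part and the error. *)
    have -> : 2 * ((a j)^-1 ^+ 2 * (a j * cj ^+ 2)) + 2 * (a j * ej ^+ 2) =
      a j * ((a j)^-1 * cj + ej) ^+ 2 + a j * ((a j)^-1 * cj - ej) ^+ 2.
      by field.
    by rewrite lerDl mulr_ge0 ?sqr_ge0// ltW.
  rewrite (le_trans h)// lerD2r ler_pM2l// ler_wpM2r//.
    by rewrite mulr_ge0 ?sqr_ge0// ltW.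
  rewrite ler_sqr ?nnegrE ?invr_ge0 ?mulr_ge0 ?(ltW a1) ?(ltW (a_gt0 _))//.
  by rewrite lef_pV2 ?posrE ?mulr_gt0// a_gap.
apply/andP; split.
  apply/eqP => z0; move: lead; rewrite z0 expr0n mulr0 leNgt => /negP; apply.
  by rewrite !divr_gt0.
apply: (@le_trans _ _ ((g / 4) ^+ 2 * (c ^+ 2 / a i0 / 4))); last first.
  by rewrite ler_wpM2l ?sqr_ge0.
rewrite (le_trans perp)//.
have s1 : (100 * a i0)^-1 ^+ 2 * perp_form y <=
    (10000)^-1 * (g ^+ 2 * (c ^+ 2 / a i0)).
  apply: (@le_trans _ _ ((100 * a i0)^-1 ^+ 2 * (g ^+ 2 * (a i0 * c ^+ 2)))).
    by rewrite ler_wpM2l ?sqr_ge0.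
  by apply/eqW; field.
have s2 : (k * g) ^+ 2 * (c ^+ 2 / a i0) <=
    (10000)^-1 * (g ^+ 2 * (c ^+ 2 / a i0)).
  rewrite exprMn -mulrA ler_wpM2r//.
    by rewrite mulr_ge0 ?sqr_ge0// divr_ge0 ?sqr_ge0// ltW.
  have -> : (10000 : R)^-1 = (100^-1) ^+ 2 by field.
  by rewrite ler_sqr ?nnegrE//; lra.
set X := c ^+ 2 / a i0 in s1 s2 e2 *.
have X0 : 0 <= g ^+ 2 * X.
  by rewrite mulr_ge0 ?sqr_ge0// divr_ge0 ?sqr_ge0// ltW.
(* As the leading term keeps at least [X / 4], the target is [g^2 X / 64], while the orthogonal part
   is at most [4 g^2 X / 10000]. *)
have -> : (g / 4) ^+ 2 * (X / 4) = 64^-1 * (g ^+ 2 * X) by field.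
by move: (perp_form e) (g ^+ 2 * X) s1 s2 e2 X0 => pe gX s1 s2 e2 X0; lra.
Qed.

End eigenbasis.

(** * Measurability, independence and the Gaussian law *)

Section measurable_vectors.
Context {R : realType} (dT : measure_display) (T : measurableType dT).

Lemma measurable_fun_cV n (f : T -> 'cV[R]_n) :
  (forall i, measurable_fun setT (fun t => f t i 0)) -> measurable_fun setT f.
Proof.
move=> mf; apply: (@measurability _ _ _ _ _ _
  (\big[setU/set0]_(i < n) preimage_set_system setT
     (fun x : 'cV[R]_n => x i 0) measurable)) => //.
move=> _ [B + <-]; rewrite -bigcup_seq => -[i _ [C mC <-]].
by rewrite !setTI -[X in measurable X]setTI; apply: (mf i).
Qed.

Lemma measurable_cV_coord n (i : 'I_n) :
  measurable_fun setT (fun x : 'cV[R]_n => x i 0).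
Proof.
move=> _ B mB; apply: sub_sigma_algebra.
by rewrite -bigcup_seq/=; exists i; [rewrite /= mem_index_enum|exists B].
Qed.

Lemma measurable_fun_cV_coord n (f : T -> 'cV[R]_n) i :
  measurable_fun setT f -> measurable_fun setT (fun t => f t i 0).
Proof.
exact: (@measurableT_comp _ _ _ _ _ _ (fun x : 'cV[R]_n => x i 0) _ f
  (measurable_cV_coord i)).
Qed.

Lemma measurable_fun_cVB n (f g : T -> 'cV[R]_n) : measurable_fun setT f ->
  measurable_fun setT g -> measurable_fun setT (fun t => f t - g t).
Proof.
move=> mf mg; apply: measurable_fun_cV => i.
under eq_fun do rewrite mxE [X in _ + X]mxE.
by apply: measurable_funB; exact: measurable_fun_cV_coord.
Qed.

Lemma measurable_fun_quad_form n (A : 'M[R]_n) (f : T -> 'cV[R]_n) :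
  measurable_fun setT f -> measurable_fun setT (fun t => quad_form A (f t)).
Proof.
move=> mf; rewrite /quad_form.
under eq_fun do rewrite mxE.
apply: measurable_sum => i; apply: measurable_funM; last exact: measurable_fun_cV_coord.
under eq_fun do rewrite mxE.
apply: measurable_sum => j; apply: measurable_funM => //.
under eq_fun do rewrite mxE.
exact: measurable_fun_cV_coord.
Qed.

Lemma measurable_fun_normB n (A : 'M[R]_n) (f : T -> 'cV[R]_n) :
  measurable_fun setT f -> measurable_fun setT (fun t => normB A (f t)).
Proof.
move=> mf; apply: (@measurableT_comp _ _ _ _ _ _ (@Num.sqrt R) _
  (fun t => quad_form A (f t))); last exact: measurable_fun_quad_form.
by apply: continuous_measurable_fun; exact: sqrt_continuous.
Qed.

Lemma norm2E n (y : 'cV[R]_n) : norm2 y = normB 1%:M y.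
Proof. by rewrite /normB /quad_form mulmx1. Qed.

Lemma measurable_fun_sqr_norm2 n (f : T -> 'cV[R]_n) :
  measurable_fun setT f -> measurable_fun setT (fun t => norm2 (f t) ^+ 2).
Proof.
move=> mf; apply: measurable_funX; under eq_fun do rewrite norm2E.
exact: measurable_fun_normB.
Qed.

Lemma measurable_fun_normalize n (f : T -> 'cV[R]_n) :
  measurable_fun setT f -> measurable_fun setT (fun t => normalize (f t)).
Proof.
move=> mf; apply: measurable_fun_cV => i.
(* The inverse becomes a power of exponent [-1], which is measurable everywhere; at norm [0] both
   are [0]. *)
under eq_fun do rewrite mxE -powR_inv1 ?sqrtr_ge0//.
apply: measurable_funM; last exact: measurable_fun_cV_coord.
apply: (@measurableT_comp _ _ _ _ _ _ (@powR R ^~ (-1)) _ (fun t => norm2 (f t))) => //.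
under eq_fun do rewrite norm2E.
exact: measurable_fun_normB.
Qed.

End measurable_vectors.

Lemma ge0_markov {R : realType} (dT : measure_display) (T : measurableType dT)
    (m : {measure set T -> \bar R}) (f : T -> R) (c : R) :
  measurable_fun setT f -> (forall t, 0 <= f t) -> 0 < c ->
  (c%:E * m [set t | (c <= f t)%R] <= \int[m]_t (f t)%:E)%E.
Proof.
move=> mf f0 c0.
have := @le_integral_comp_abse _ T R m setT measurableT (fun t => (f t)%:E) c id.
rewrite setTI; under eq_integral do rewrite /= ger0_norm ?f0//.
rewrite (_ : [set x | _] = [set t | c <= f t]).
  by apply => //; exact/measurable_EFinP.
by apply/seteqP; split => t /=; rewrite lee_fin ger0_norm.
Qed.

Lemma bigcap_in_seq (I : eqType) (T : Type) (s : seq I) (f : I -> set T) :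
  \bigcap_(j in [set` s]) f j = \big[setI/setT]_(j <- s) f j.
Proof.
elim: s => [|i s IHs]; first by rewrite big_nil; apply/seteqP; split=> x.
rewrite big_cons -IHs; apply/seteqP; split=> [x fx|x [fix_ fx] j /=].
  split; first by apply: fx; rewrite /= mem_head.
  by move=> j /= js; apply: fx; rewrite /= inE js orbT.
by rewrite inE => /predU1P[->//|]; exact: fx.
Qed.

(** * Independence: from product events to generated sigma-algebras and joint laws *)

Section independence.
Context {R : realType} (dO : measure_display) (Omega : measurableType dO).
Variable P : probability Omega R.

(** Dynkin's argument. As functions of [E], the two sides are finite measures that agree on the
    pi-system [G] of finite intersections of events from the families other than [F i], hence on the
    sigma-algebra it generates. *)
Lemma mutually_independentD1 (I : eqType) (F : I -> set (set Omega)) i A E :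
  (forall j, F j `<=` measurable) -> (forall j, setI_closed (F j)) ->
  (forall j, F j setT) -> mutually_independent P F ->
  F i A -> <<s \bigcup_(j in [set j | j != i]) F j >> E ->
  P (A `&` E) = (P A * P E)%E.
Proof.
move=> Fm FI FT indF FiA.
pose G : set (set Omega) := [set E | exists (s : seq I) (f : I -> set Omega),
  [/\ uniq s, i \notin s, (forall j, F j (f j)) &
      E = \bigcap_(j in [set` s]) f j]].
have mA : measurable A by exact: Fm FiA.
have Gm : G `<=` measurable.
  move=> _ [s [f [_ _ Ff ->]]]; rewrite bigcap_in_seq.
  by apply: bigsetI_measurable => j _; exact/(Fm j)/Ff.
have GT : G setT.
  exists [::], (fun=> setT); split => //.
  by apply/seteqP; split => // x _ j.
have GI : setI_closed G.
  move=> _ _ [s1 [f1 [u1 i1 F1 ->]]] [s2 [f2 [u2 i2 F2 ->]]].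
  (* Padding with [setT] merges two intersections over different index lists; an index common to
     both is handled by the closure of [F j] under intersection. *)
  pose f j := (if j \in s1 then f1 j else setT) `&`
              (if j \in s2 then f2 j else setT).
  exists (undup (s1 ++ s2)), f; split.
  - exact: undup_uniq.
  - by rewrite mem_undup mem_cat negb_or i1.
  - by move=> j; apply: FI; case: ifP.
  - apply/seteqP; split=> [x [h1 h2] j _|x h].
      by rewrite /f; split; case: ifP => // js; [exact: h1|exact: h2].
    split=> j /= js; have /= := h j; rewrite mem_undup mem_cat js ?orbT /f.
      by rewrite js => /(_ isT)[].
    by rewrite js => /(_ isT)[].
have FG : \bigcup_(j in [set j | j != i]) F j `<=` G.
  move=> E' [j /= ji FjE]; exists [:: j], (fun k => if k == j then E' else setT).
  split => //; first by rewrite inE eq_sym.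
    by move=> k; case: eqP => [->|].
  apply/seteqP; split=> [x Ex k /=|x /(_ j)]; first by rewrite inE => ->.
  by rewrite /= inE eqxx; apply.
move=> /(sub_sigma_algebra2 FG) sE.
have PA_ge0 : 0 <= fine (P A) by rewrite fine_ge0.
pose m2 := mscale (NngNum PA_ge0) P.
have -> : (P A * P E)%E = m2 E by rewrite /m2 /mscale /= fineK// fin_num_measure.
rewrite setIC -[LHS]/(mrestr P mA E).
apply: (g_sigma_algebra_measure_unique G Gm (fun=> setT)) sE => //.
- exact: bigcup_const.
- move=> _ [s [f [us is_ Ff ->]]].
  rewrite -[LHS]/(P (_ `&` A)) -[RHS]/((fine (P A))%:E * P _)%E.
  rewrite fineK ?fin_num_measure// setIC.
  (* Independence is applied to the lists [i :: s] and [s], with one common choice of events that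
     takes the value [A] at [i]. *)
  pose f' j := if j == i then A else f j.
  have e1 : A `&` \bigcap_(j in [set` s]) f j = \bigcap_(j in [set` i :: s]) f' j.
    rewrite !bigcap_in_seq big_cons /f' eqxx; congr (_ `&` _).
    by apply: eq_big_seq => j js; case: eqP js => // ->; rewrite (negbTE is_).
  have e2 : \bigcap_(j in [set` s]) f j = \bigcap_(j in [set` s]) f' j.
    rewrite !bigcap_in_seq.
    by apply: eq_big_seq => j js; rewrite /f'; case: eqP js => // ->; rewrite (negbTE is_).
  have F' j : F j (f' j) by rewrite /f'; case: eqP => // ->.
  rewrite e1 e2 !indF//=; last by rewrite is_.
  by rewrite big_cons {1}/f' eqxx.
- move=> k; rewrite /= /mrestr setTI.
  by rewrite -ge0_fin_numE// fin_num_measure.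
Qed.

Context {d1 d2 : measure_display} {T1 : measurableType d1} {T2 : measurableType d2}.

(** The joint law of [(X, Y)] agrees with the product of the marginals on rectangles, hence
    everywhere; the product measure is then evaluated by sections. *)
Lemma independent_pair_prob (m : probability T2 R) (X : Omega -> T1) (Y : Omega -> T2)
    (E : set (T1 * T2)) :
  measurable_fun setT X -> has_law P Y m ->
  (forall A B, measurable A -> measurable B ->
    P (X @^-1` A `&` Y @^-1` B) = (P (X @^-1` A) * P (Y @^-1` B))%E) ->
  measurable E ->
  P [set w | E (X w, Y w)] = (\int[P]_w m (xsection E (X w)))%E.
Proof.
move=> mX [mY lawY] indXY mE.
have mXY : measurable_fun setT (fun w => (X w, Y w)) by exact: measurable_fun_pair.
pose X' : {mfun Omega >-> T1} := HB.pack X (isMeasurableFun.Build _ _ _ _ _ mX).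
pose XY : {mfun Omega >-> (T1 * T2)%type} :=
  HB.pack (fun w => (X w, Y w)) (isMeasurableFun.Build _ _ _ _ _ mXY).
have := @product_measure_unique _ _ _ _ _ (distribution P X') m
  (distribution P XY).
move=> /(_ _ E mE) H.
rewrite (_ : P _ = distribution P XY E)// -H; last first.
  move=> A B mA mB; rewrite -[RHS]/(P (X @^-1` A) * m B)%E -lawY//.
  by rewrite -indXY.
rewrite /product_measure1 /=.
by rewrite ge0_integral_distribution//; exact: measurable_fun_xsection.
Qed.

End independence.

(** * The normal law on the real line *)

Section normal_law.
Context {R : realType}.
Local Notation mu := (@lebesgue_measure R).
Import HBNNSimple.

(** On indicators this is the definition of the law; linearity extends it to simple functions, and
    monotone convergence to all nonnegative ones. *)
Lemma ge0_integral_normal_prob (m s : R) (f : measurableTypeR R -> \bar R) :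
  measurable_fun setT f -> (forall x, 0 <= f x)%E ->
  (\int[normal_prob m s]_x f x = \int[mu]_x (f x * (normal_pdf m s x)%:E))%E.
Proof.
move=> mf f0; set p := normal_pdf m s.
have mp : measurable_fun setT p by exact: measurable_normal_pdf.
have p0 x : 0 <= p x by exact: normal_pdf_ge0.
have simple (g : {nnsfun measurableTypeR R >-> R}) :
    (\int[normal_prob m s]_x (g x)%:E = \int[mu]_x ((g x)%:E * (p x)%:E))%E.
  under [LHS]eq_integral do rewrite fimfunE -fsumEFin//.
  rewrite [LHS]ge0_integral_fsum//; last 2 first.
    - by move=> r; exact/measurable_EFinP/measurableT_comp.
    - by move=> n x _; rewrite EFinM nnfun_muleindic_ge0.
  under [RHS]eq_integral.
    move=> x xD; rewrite fimfunE -fsumEFin// ge0_mule_fsuml; last first.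
      by move=> r; rewrite EFinM nnfun_muleindic_ge0.
    over.
  rewrite [RHS]ge0_integral_fsum//; last 2 first.
    - move=> r; apply: emeasurable_funM; last exact/measurable_EFinP.
      exact/measurable_EFinP/measurableT_comp.
    - move=> r x _; apply: mule_ge0; last by rewrite lee_fin.
      by rewrite EFinM nnfun_muleindic_ge0.
  apply: eq_fsbigr => r _.
  rewrite integralZl_indic_nnsfun//= integral_indic// setIT.
  (* A negative [r] is not a value of the nonnegative simple function, so its level set is empty. *)
  have [r0|r0] := ltP r 0.
    rewrite preimage_nnfun0// measure0 mule0 integral0_eq// => x _.
    by rewrite indicE memNset ?mulr0 ?mul0e.
  under [RHS]eq_integral do rewrite EFinM -muleA.
  rewrite ge0_integralZl//; last 2 first.
    - by apply: emeasurable_funM; exact/measurable_EFinP.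
    - by move=> x _; rewrite mule_ge0 ?lee_fin.
  congr (_ * _)%E; rewrite /normal_prob [LHS]integral_mkcond.
  apply: eq_integral => x _; rewrite patchE indicE.
  by case: (x \in _); rewrite ?mul1e ?mul0e.
pose f_ := nnsfun_approx measurableT mf.
have cf x : (f_ n x)%:E @[n --> \oo] --> f x by exact: cvg_nnsfun_approx.
have ndf x : {homo (fun n => f_ n x) : a b / (a <= b)%N >-> a <= b}.
  by move=> a b ab; exact/lefP/nd_nnsfun_approx.
transitivity (limn (fun n => \int[normal_prob m s]_x (f_ n x)%:E))%E.
  rewrite -monotone_convergence//.
  - by apply: eq_integral => x _; apply/esym/cvg_lim => //; exact: cf.
  - by move=> n; exact/measurable_EFinP.
  - by move=> n x _; rewrite lee_fin.
  - by move=> x _ a b ab; rewrite lee_fin; exact: ndf.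
under eq_fun do rewrite simple.
rewrite -monotone_convergence//.
- apply: eq_integral => x _; apply/cvg_lim => //.
  by apply: cvgeZr => //; exact: cf.
- by move=> n; apply: emeasurable_funM; exact/measurable_EFinP.
- by move=> n x _; rewrite mule_ge0 ?lee_fin.
- by move=> x _ a b ab; rewrite lee_wpmul2r ?lee_fin//; exact: ndf.
Qed.

(* On the density level, [s^2 e^(-s^2/2) <= 3 e^(3 s^2/8) e^(-s^2/2)], which is a
   multiple of the density of the centred normal law of deviation 2. *)
Lemma normal_second_moment_le :
  (\int[normal_prob 0 1]_x ((x : R) ^+ 2)%:E <= 6%:E)%E.
Proof.
rewrite ge0_integral_normal_prob; last 2 first.
  - by apply/measurable_EFinP; exact: measurable_funX.
  - by move=> x; rewrite lee_fin sqr_ge0.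
have -> : 6%:E = (\int[mu]_x (6%:E * (normal_pdf 0 2 x)%:E))%E.
  rewrite ge0_integralZl//.
  - by rewrite integral_normal_pdf mule1.
  - by apply/measurable_EFinP; exact: measurable_normal_pdf.
  - by move=> x _; rewrite lee_fin normal_pdf_ge0.
apply: ge0_le_integral => //.
- by move=> x _; rewrite mule_ge0// lee_fin ?sqr_ge0 ?normal_pdf_ge0.
- apply: emeasurable_funM; apply/measurable_EFinP.
    exact: measurable_funX.
  exact: measurable_normal_pdf.
- by apply: measurable_funeM; apply/measurable_EFinP; exact: measurable_normal_pdf.
move=> x _; rewrite -!EFinM lee_fin !normal_pdfE// /normal_fun.
(* The ratio 2 of the peaks and the bound 3 below account for the constant 6. *)
have -> : normal_peak (1 : R) = 2 * normal_peak 2.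
  rewrite /normal_peak expr1n mul1r -mulrnAr sqrtrM ?sqr_ge0// sqrtr_sqr ger0_norm//.
  by rewrite invfM mulrA mulfV// mul1r.
rewrite !subr0 expr1n.
have -> : - x ^+ 2 / 2 = - (3 / 8 * x ^+ 2) + - x ^+ 2 / ((2 : R) ^+ 2 *+ 2) by field.
rewrite expRD.
set E := expR (- x ^+ 2 / ((2 : R) ^+ 2 *+ 2)).
have E0 : 0 <= E by exact: expR_ge0.
have pk : 0 <= normal_peak (2 : R) by exact: normal_peak_ge0.
(* From [1 + u <= expR u], since [x^2 <= 3 + 9/8 * x^2]. *)
have h : x ^+ 2 * expR (- (3 / 8 * x ^+ 2)) <= 3.
  rewrite expRN ler_pdivrMr ?expR_gt0//.
  have := expR_ge1Dx (3 / 8 * x ^+ 2); have := sqr_ge0 x; lra.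
have := ler_wpM2r (mulr_ge0 pk E0) h.
by rewrite !mulrA => h'; lra.
Qed.

(** The event is an interval of length [2 * r / |a|], and the standard normal density is at most
    1. *)
Lemma normal_prob_slab_le (a c r : R) : a != 0 -> 0 <= r ->
  (normal_prob 0 1 [set u : R | (`|a * u + c| < r)%R] <= (2 * r / `|a|)%:E)%E.
Proof.
move=> a0 r0; have a_gt0 : 0 < `|a| by rewrite normr_gt0.
set i := `]((- c / a) - r / `|a|), ((- c / a) + r / `|a|)[.
have -> : [set u : R | `|a * u + c| < r] = [set` i].
  have eqi u : (`|a * u + c| < r) = (u \in i).
    rewrite in_itv /= -ltr_distl ltr_pdivlMr// -normrM.
    by congr (`|_| < _); field.
  by apply/seteqP; split => u /=; rewrite eqi.
rewrite /normal_prob.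
apply: (@le_trans _ _ (\int[mu]_(x in [set` i]) cst 1%:E x)%E).
  apply: ge0_le_integral => //.
  - by move=> x _; rewrite lee_fin normal_pdf_ge0.
  - by apply/measurable_EFinP/measurable_funTS; exact: measurable_normal_pdf.
  - move=> x _; rewrite lee_fin (le_trans (normal_pdf_ub _ _ _))// ?oner_neq0//.
    have h : 1 <= 1 ^+ 2 * pi *+ 2 :> R.
      by rewrite expr1n mul1r mulr2n; have := @pi_ge2 R; lra.
    have h1 : 1 <= Num.sqrt (1 ^+ 2 * pi *+ 2) :> R.
      by rewrite -[leLHS]sqrtr1 ler_sqrt// (le_trans ler01).
    by rewrite /normal_peak invf_le1// (lt_le_trans ltr01).
rewrite integral_cst//= mul1e lebesgue_measure_itv /=.
case: ifPn => _; rewrite lee_fin.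
  by apply: eqW; field; rewrite a0 gt_eqF.
by rewrite divr_ge0 ?mulr_ge0// ltW.
Qed.

End normal_law.

(** * Sigma-algebras generated by random variables, and conditioning on them *)

Section sigma_of_lemmas.
Context (dO dT : measure_display) (Omega : measurableType dO)
  (T : measurableType dT) (X : Omega -> T).

Lemma sigma_of_measurable : measurable_fun setT X -> sigma_of X `<=` measurable.
Proof. by move=> mX _ [B mB <-]; exact: mX. Qed.

Lemma sigma_of_setI : setI_closed (sigma_of X).
Proof.
move=> _ _ [A mA <-] [B mB <-]; exists (A `&` B); first exact: measurableI.
by rewrite preimage_setI setIIr.
Qed.

Lemma sigma_ofT : sigma_of X setT.
Proof. by exists setT => //; rewrite preimage_setT setTI. Qed.

Lemma measurable_fun_sigma_of (C : set (set Omega)) : sigma_of X `<=` C ->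
  measurable_fun setT (X : g_sigma_algebraType C -> T).
Proof. by move=> XC _ B mB; apply: sub_sigma_algebra; apply: XC; exists B. Qed.

End sigma_of_lemmas.

(** [X] is measurable for the families other than [F i], hence independent of [Y]. A bound on the
    probability over [Y] with [X] frozen can therefore be averaged. *)
Lemma independent_prob_le {R : realType} (dO d1 d2 : measure_display)
    (Omega : measurableType dO) (T1 : measurableType d1) (T2 : measurableType d2)
    (P : probability Omega R) (m : probability T2 R) (I : eqType)
    (F : I -> set (set Omega)) (i : I) (X : Omega -> T1) (Y : Omega -> T2)
    (E : set (T1 * T2)) (h : Omega -> R) :
  (forall j, F j `<=` measurable) -> (forall j, setI_closed (F j)) ->
  (forall j, F j setT) -> mutually_independent P F ->
  has_law P Y m -> sigma_of Y `<=` F i ->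
  measurable_fun setT
    (X : g_sigma_algebraType (\bigcup_(j in [set j | j != i]) F j) -> T1) ->
  measurable E -> measurable_fun setT h ->
  (forall w, (m (xsection E (X w)) <= (h w)%:E)%E) ->
  (P [set w | E (X w, Y w)] <= \int[P]_w (h w)%:E)%E.
Proof.
move=> Fm FI FT indF lawY YF mX mE mh hE.
have FO : <<s \bigcup_(j in [set j | j != i]) F j >> `<=` measurable.
  apply: smallest_sub; first exact: sigma_algebra_measurable.
  by move=> A [j _]; exact: Fm.
have mX' : measurable_fun setT X.
  by move=> _ B mB; apply: FO; exact: mX.
rewrite (independent_pair_prob mX' lawY)//.
  apply: ge0_le_integral => //.
  - apply: (@measurableT_comp _ _ _ _ _ _ (fun t => m (xsection E t)) _ X) => //.
    exact: measurable_fun_xsection.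
  - exact/measurable_EFinP.
move=> A B mA mB; rewrite setIC [RHS]muleC.
apply: (mutually_independentD1 (i := i) Fm FI FT indF).
  by apply: YF; exists B => //; rewrite setTI.
by rewrite -[X in <<s _ >> X]setTI; exact: mX.
Qed.

(** * Anticoncentration and second moment of a standard Gaussian vector *)

Section gaussian_vector.
Context {R : realType} (dO : measure_display) (Omega : measurableType dO).
Variables (P : probability Omega R) (d : nat) (x : Omega -> 'cV[R]_d).
Hypothesis gx : standard_gaussian_vector P x.

Lemma measurable_gaussian : measurable_fun setT x.
Proof. by apply: measurable_fun_cV => i; have [/(_ i)[]] := gx. Qed.

(** Otherwise every squared entry is below [1 / d], and they cannot sum to 1. *)
Lemma exists_large_entry (u : 'cV[R]_d) : norm2 u = 1 ->
  exists i, 1 <= Num.sqrt d%:R * `|u i 0|.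
Proof.
move=> u1; apply: contrapT => /forallNP h.
have {u1} : (u^T *m u) 0 0 = 1.
  rewrite -[LHS]sqr_sqrtr; first by rewrite -/(norm2 u) u1 expr1n.
  by rewrite mxE sumr_ge0// => k _; rewrite mxE -expr2 sqr_ge0.
rewrite mxE => /eqP; apply/negP; rewrite lt_eqF//.
have [d0|d0] := posnP d.
  by rewrite big1 ?ltr01// => k; exfalso; case: k; rewrite d0.
have -> : 1 = \sum_(k < d) (d%:R : R)^-1.
  by rewrite sumr_const card_ord -[RHS]mulr_natl mulfV// pnatr_eq0 -lt0n.
apply: ltr_sum => [|k _]; first by apply/hasP; exists (Ordinal d0); rewrite ?mem_index_enum.
have d_gt0 : 0 < d%:R :> R by rewrite ltr0n.
rewrite mxE -expr2 -[_^-1]mul1r ltr_pdivlMr// mulrC.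
rewrite -[d%:R]sqr_sqrtr ?ler0n// -[u k 0 ^+ 2]real_normK ?num_real// -exprMn.
have := h k => /negP; rewrite -ltNge => hk.
by rewrite expr_lt1// mulr_ge0 ?sqrtr_ge0.
Qed.

Lemma gaussian_anticoncentration (u : 'cV[R]_d) (r : R) : norm2 u = 1 -> 0 <= r ->
  (P [set w | (`|(u^T *m x w) 0 0| < r)%R] <= (2 * r * Num.sqrt d%:R)%:E)%E.
Proof.
move=> u1 r0; have [i ui] := exists_large_entry u1.
have ui0 : u i 0 != 0 by apply: contraTneq ui => ->; rewrite normr0 mulr0 -ltNge ltr01.
have [lawx indx] := gx.
(* [W] gathers the other coordinates: it is independent of [x w i 0] and only shifts the slab, whose
   width is at most [2 * r * sqrt d] by the choice of [i]. *)
pose W w := \sum_j if j != i then u j 0 * x w j 0 else 0.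
pose E : set (R * measurableTypeR R) := [set p | `|u i 0 * p.2 + p.1| < r].
have -> : [set w | `|(u^T *m x w) 0 0| < r] = [set w | E (W w, x w i 0)].
  have WE w : (u^T *m x w) 0 0 = u i 0 * x w i 0 + W w.
    rewrite mxE (bigD1 i)//= mxE /W -big_mkcond; congr (_ + _).
    by apply: eq_bigr => j _; rewrite mxE.
  by apply/seteqP; split => w /=; rewrite WE.
have -> : ((2 * r * Num.sqrt d%:R)%:E = \int[P]_w (2 * r * Num.sqrt d%:R)%:E)%E.
  by rewrite integral_cst//= probability_setT mule1.
apply: (@independent_prob_le _ _ _ _ _ _ _ P (normal_prob 0 1) _
  (fun i : 'I_d => sigma_of (fun w => x w i 0)) i W (fun w => x w i 0)) => //.
- by move=> j; apply: sigma_of_measurable; case: (lawx j).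
- by move=> j; exact: sigma_of_setI.
- by move=> j; exact: sigma_ofT.
- exact: (lawx i).
- apply: measurable_sum => j; case: (boolP (j != i)) => // ji.
  apply: measurable_funM => //; apply: measurable_fun_sigma_of.
  by move=> A hA; exists j.
- rewrite /E -[X in measurable X]setTI.
  apply: (measurable_fun_ltr (f := fun p : R * measurableTypeR R => `|u i 0 * p.2 + p.1|)
    (g := cst r)) => //.
  apply: measurableT_comp => //; apply: measurable_funD => //.
  exact: measurable_funM.
- move=> w; rewrite (_ : xsection _ _ = [set s : R | `|u i 0 * s + W w| < r]).
    rewrite (le_trans (normal_prob_slab_le _ _ _))// lee_fin.
    rewrite ler_pdivrMr ?normr_gt0// -[leLHS]mulr1 -[leRHS]mulrA ler_wpM2l// mulr_ge0//.
  by apply/seteqP; split => s; rewrite /xsection /= inE.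
Qed.

Lemma gaussian_second_moment :
  (\int[P]_w (norm2 (x w) ^+ 2)%:E <= (6 * d%:R)%:E)%E.
Proof.
have [lawx _] := gx.
have nE w : norm2 (x w) ^+ 2 = \sum_i (x w i 0) ^+ 2.
  have E : ((x w)^T *m x w) 0 0 = \sum_i (x w i 0) ^+ 2.
    by rewrite mxE; apply: eq_bigr => i _; rewrite mxE expr2.
  by rewrite /norm2 sqr_sqrtr E// sumr_ge0// => i _; exact: sqr_ge0.
under eq_integral do rewrite nE -sumEFin.
rewrite ge0_integral_sum//; last 2 first.
  - by move=> i; apply/measurable_EFinP/measurable_funX; case: (lawx i).
  - by move=> i w _; rewrite lee_fin sqr_ge0.
have -> : (6 * d%:R)%:E = (\sum_(i < d) 6%:E)%E :> \bar R.
  by rewrite sumEFin sumr_const card_ord mulr_natr.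
apply: lee_sum => i _.
have [mxi law] := lawx i.
have mxi' : measurable_fun setT (fun w => x w i 0 : measurableTypeR R) by [].
pose X : {mfun Omega >-> measurableTypeR R} :=
  HB.pack (fun w => x w i 0 : measurableTypeR R) (isMeasurableFun.Build _ _ _ _ _ mxi').
have := @ge0_integral_distribution _ _ _ _ _ P X (fun s => (s ^+ 2)%:E).
rewrite /comp => <-; last 2 first.
  - by apply/measurable_EFinP; exact: measurable_funX.
  - by move=> s; rewrite lee_fin sqr_ge0.
apply: le_trans normal_second_moment_le.
by rewrite (eq_measure_integral (normal_prob 0 1))// => A mA _; exact: law.
Qed.

End gaussian_vector.

(** * Shift-and-invert iteration with a randomized solver *)

(** Measurability is asked of the seeds before [t], on an arbitrary [T], so that [T] can also carry
    the sigma-algebra generated by [x] and the seeds other than [U t]. *)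
Lemma measurable_solve_iter {R : realType} {d : nat} (dS dT : measure_display)
    (S : measurableType dS) (T : measurableType dT)
    (solve : S -> 'cV[R]_d -> 'cV[R]_d) (x : T -> 'cV[R]_d) (U : nat -> T -> S) t :
  measurable_fun setT (fun p : S * 'cV[R]_d => solve p.1 p.2) ->
  measurable_fun setT x ->
  (forall s, (s < t)%N -> measurable_fun setT (U s)) ->
  measurable_fun setT (fun w => solve_iter solve (U ^~ w) (x w) t).
Proof.
move=> msolve mx; elim: t => [_|t IHt mU] /=; first exact: measurable_fun_normalize.
apply: measurable_fun_normalize.
apply: (@measurableT_comp _ _ _ _ _ _ (fun p : S * 'cV[R]_d => solve p.1 p.2) _
  (fun w => (U t w, solve_iter solve (U ^~ w) (x w) t))) => //.
apply: measurable_fun_pair; first exact: mU.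
by apply: IHt => s st; apply: mU; rewrite ltnS ltnW.
Qed.

Lemma solve_iter_normalized {R : realType} {d : nat} (S : Type)
    (solve : S -> 'cV[R]_d -> 'cV[R]_d) seeds x t :
  exists y, solve_iter solve seeds x t = normalize y.
Proof. by case: t => [|t]; eexists. Qed.

Section power_iteration.
Context {R : realType} {d : nat}.
Variables (v : 'I_d -> 'cV[R]_d) (A : 'M[R]_d) (a : 'I_d -> R) (i0 : 'I_d).
Hypothesis ortho : forall i j, ((v i)^T *m v j) 0 0 = (i == j)%:R.
Hypothesis Av : forall j, A *m v j = a j *: v j.
Hypothesis a_gt0 : forall j, 0 < a j.
Hypothesis a_gap : forall j, j != i0 -> 100 * a i0 <= a j.

(** The threshold is a function because it will depend on the random start. *)
Lemma measurable_aligned (dT : measure_display) (T : measurableType dT)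
    (g : T -> R) (f : T -> 'cV[R]_d) :
  measurable_fun setT g -> measurable_fun setT f ->
  measurable [set t | aligned v a i0 (g t) (f t)].
Proof.
move=> mg mf.
have mc i : measurable_fun setT (fun t => coord v i (f t)).
  under eq_fun do rewrite coordE.
  apply: measurable_sum => k; apply: measurable_funM => //.
  exact: measurable_fun_cV_coord.
have -> : [set t | aligned v a i0 (g t) (f t)] =
    ~` [set t | coord v i0 (f t) == 0] `&`
    [set t | perp_form v a i0 (f t) <= g t ^+ 2 * (a i0 * coord v i0 (f t) ^+ 2)].
  apply/seteqP; split=> t /=; rewrite /aligned.
    by move=> /andP[/negP ? ?].
  by move=> [/negP ? ?]; apply/andP.
apply: measurableI.
  apply: measurableC; rewrite -[X in measurable X]setTI.
  exact: (measurable_fun_eqr (f := fun t => coord v i0 (f t)) (g := cst 0)).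
rewrite -[X in measurable X]setTI.
apply: (measurable_fun_ler (f := fun t => perp_form v a i0 (f t))
  (g := fun t => g t ^+ 2 * (a i0 * coord v i0 (f t) ^+ 2))) => //.
  rewrite /perp_form; under eq_fun do rewrite big_mkcond.
  apply: measurable_sum => j; case: (boolP (j != i0)) => // _.
  by apply: measurable_funM => //; exact: measurable_funX.
apply: measurable_funM; first exact: measurable_funX.
by apply: measurable_funM => //; exact: measurable_funX.
Qed.

Context (dS : measure_display) (S : measurableType dS) (mu : probability S R).
Variables (solve : S -> 'cV[R]_d -> 'cV[R]_d) (eps : R).
Hypothesis msolve : measurable_fun setT (fun p : S * 'cV[R]_d => solve p.1 p.2).
Hypothesis eps_ge0 : 0 <= eps.
Hypothesis solveP : forall y, norm2 y = 1 ->
  (\int[mu]_s (normB A (solve s y - invmx A *m y))%:E <=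
   (eps * normB A ((quad_form A y)^-1 *: y - invmx A *m y))%:E)%E.

Lemma measurable_solve y : measurable_fun setT (solve ^~ y).
Proof.
apply: (@measurableT_comp _ _ _ _ _ _ (fun p : S * 'cV[R]_d => solve p.1 p.2) _
  (fun s => (s, y))) => //.
Qed.

(** Markov's inequality: a failure forces the solver error to be at least [k * D], while its mean is
    at most [eps * D]. *)
Lemma solve_failure_le g y : 0 < g -> norm2 y = 1 -> aligned v a i0 g y ->
  (mu [set s | ~~ aligned v a i0 (g / 4) (solve s y)] <=
   (eps * (100 + 2 * g))%:E)%E.
Proof.
move=> g0 y1 al.
(* This [k] satisfies both [100 * k <= 1] and [2 * (k * g) <= 1], as the contraction requires. *)
pose k := (100 + 2 * g)^-1.
have k0 : 0 < k by rewrite invr_gt0; lra.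
have kE : k * (100 + 2 * g) = 1 by rewrite mulVf//; lra.
have kg0 : 0 < k * g by rewrite mulr_gt0.
set D := g * (`|coord v i0 y| / Num.sqrt (a i0)).
have D0 : 0 < D.
  by rewrite mulr_gt0// divr_gt0 ?sqrtr_gt0// normr_gt0; case/andP: al.
have a_min j : a i0 <= a j.
  have [->//|ji] := eqVneq j i0.
  by rewrite (le_trans _ (a_gap ji))//; have := a_gt0 i0; lra.
pose e s := normB A (solve s y - invmx A *m y).
have e0 s : 0 <= e s by exact: sqrtr_ge0.
have me : measurable_fun setT e.
  apply: measurable_fun_normB; apply: measurable_fun_cVB => //.
  exact: measurable_solve.
have int_e : (\int[mu]_s (e s)%:E <= (eps * D)%:E)%E.
  rewrite (le_trans (solveP y1))// lee_fin ler_wpM2l//.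
  by apply: residual_le => //; exact: ltW.
have kD0 : 0 < k * D by rewrite mulr_gt0.
have mkv : ((k * D)%:E * mu [set s | (k * D <= e s)%R] <= (eps * D)%:E)%E.
  by apply: le_trans int_e; exact: ge0_markov.
have mbig : measurable [set s | k * D <= e s].
  rewrite -[X in measurable X]setTI.
  exact: (measurable_fun_ler (f := cst (k * D)) (g := e)).
have sub : [set s | ~~ aligned v a i0 (g / 4) (solve s y)] `<=`
    [set s | k * D <= e s].
  move=> s /= nal; rewrite leNgt; apply: contra nal => /ltW small.
  rewrite -[solve s y](subrKC (invmx A *m y)).
  by apply: (@aligned_contraction _ _ v ortho A a i0 Av a_gt0 g k) => //; lra.
apply: le_trans (le_measure mu _ _ sub) _; rewrite ?inE//.
  rewrite (_ : [set s | _] =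
    ~` [set s | aligned v a i0 (cst (g / 4) s) (solve s y)]).
    by apply: measurableC; apply: measurable_aligned => //; exact: measurable_solve.
  by apply/seteqP; split => s /= /negP.
rewrite -(@lee_pmul2l _ (k * D)%:E)//.
rewrite (le_trans mkv)// -EFinM lee_fin.
by apply: eqW; rewrite -[LHS]mulr1 -[X in _ * X = _]kE; ring.
Qed.

Context (dO : measure_display) (Omega : measurableType dO).
Variables (P : probability Omega R) (x : Omega -> 'cV[R]_d) (U : nat -> Omega -> S).
Hypothesis mx : measurable_fun setT x.
Hypothesis fresh : fresh_seeds P mu x U.

Local Notation x_ t := (fun w => solve_iter solve (U ^~ w) (x w) t).

Lemma measurable_iterates t : measurable_fun setT (x_ t).
Proof. by apply: measurable_solve_iter => // s _; case: (fresh) => /(_ s)[]. Qed.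

(** The threshold depends on [x] alone, and the iterate on [x] and the seeds before [t]. Both are
    frozen while the independent seed [U t] is integrated out. *)
Lemma step_failure_le (g : 'cV[R]_d -> R) t : measurable_fun setT g ->
  (forall z, 0 < g z) ->
  (P [set w | aligned v a i0 (g (x w)) (x_ t w) &&
              ~~ aligned v a i0 (g (x w) / 4) (x_ t.+1 w)]
   <= \int[P]_w (eps * (100 + 2 * g (x w)))%:E)%E.
Proof.
move=> mg g0; have [lawU indU] := fresh.
pose E : set (('cV[R]_d * 'cV[R]_d) * S) :=
  [set p | aligned v a i0 (g p.1.1) p.1.2 &&
           ~~ aligned v a i0 (g p.1.1 / 4) (normalize (solve p.2 p.1.2))].
pose F (k : option nat) := if k is Some t then sigma_of (U t) else sigma_of x.
have FN k : k != Some t -> F k `<=` \bigcup_(j in [set j | j != Some t]) F j.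
  by move=> kt B FB; exists k.
rewrite -[X in P X]/[set w | E ((x w, x_ t w), U t w)].
apply: (@independent_prob_le _ _ _ _ _ _ _ P mu _ F (Some t)) => //.
- by case=> [s|]; apply: sigma_of_measurable => //; case: (lawU s).
- by case=> [s|]; exact: sigma_of_setI.
- by case=> [s|]; exact: sigma_ofT.
- apply: measurable_fun_pair.
    by apply: measurable_fun_sigma_of; exact: (FN None).
  apply: measurable_solve_iter => //.
    by apply: measurable_fun_sigma_of; exact: (FN None).
  move=> s st; apply: measurable_fun_sigma_of; apply: (FN (Some s)).
  by apply/eqP => -[] ts; rewrite ts ltnn in st.
- have mg1 : measurable_fun setT (fun p : ('cV[R]_d * 'cV[R]_d) * S => g p.1.1).
    apply: (@measurableT_comp _ _ _ _ _ _ g _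
      (fun p : ('cV[R]_d * 'cV[R]_d) * S => p.1.1)) => //.
    exact: measurableT_comp.
  have m12 : measurable_fun setT (fun p : ('cV[R]_d * 'cV[R]_d) * S => p.1.2).
    exact: measurableT_comp.
  have -> : E = [set p | aligned v a i0 (g p.1.1) p.1.2] `&`
     ~` [set p | aligned v a i0 (g p.1.1 / 4) (normalize (solve p.2 p.1.2))].
    apply/seteqP; split=> p /=; rewrite /E /=.
      by move=> /andP[? /negP ?].
    by move=> [? /negP ?]; apply/andP.
  apply: measurableI; first exact: measurable_aligned.
  apply: measurableC; apply: measurable_aligned; first exact: measurable_funM.
  apply: measurable_fun_normalize.
  apply: (@measurableT_comp _ _ _ _ _ _ (fun p : S * 'cV[R]_d => solve p.1 p.2) _
    (fun p : ('cV[R]_d * 'cV[R]_d) * S => (p.2, p.1.2))) => //.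
  exact: measurable_fun_pair.
- apply: measurable_funM => //; apply: measurable_funD => //.
  by apply: measurable_funM => //; exact: measurableT_comp.
move=> w; case: (boolP (aligned v a i0 (g (x w)) (x_ t w))) => al; last first.
  rewrite (_ : xsection _ _ = set0); last first.
    by apply/seteqP; split=> s //; rewrite /xsection /= inE /E /= (negbTE al).
  rewrite measure0 lee_fin mulr_ge0//; have := g0 (x w); lra.
have y1 : norm2 (x_ t w) = 1.
  have [y yE] := solve_iter_normalized solve (U ^~ w) (x w) t.
  by rewrite yE in al *; exact: norm2_aligned_normalize al.
apply: le_trans (solve_failure_le (g0 (x w)) y1 al).
have mf : measurable [set s | aligned v a i0 (cst (g (x w) / 4) s) (solve s (x_ t w))].
  by apply: measurable_aligned => //; exact: measurable_solve.
have mn : measurable [set s | aligned v a i0 (cst (g (x w) / 4) s)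
    (normalize (solve s (x_ t w)))].
  apply: measurable_aligned => //; apply: measurable_fun_normalize.
  exact: measurable_solve.
have eE : xsection E (x w, x_ t w) =
    ~` [set s | aligned v a i0 (g (x w) / 4) (normalize (solve s (x_ t w)))].
  by apply/seteqP; split=> s; rewrite /xsection /= inE /E /= al /= => /negP.
(* Normalizing preserves alignment, so failure after it implies failure before it. *)
rewrite eE (_ : [set s | ~~ _] = ~` [set s | aligned v a i0 (g (x w) / 4) (solve s (x_ t w))]).
  apply: le_measure; rewrite ?inE; [exact: measurableC..|].
  by apply: subsetC => s /=; exact: aligned_normalize.
by apply/seteqP; split=> s /= /negP.
Qed.

Hypothesis d_gt0 : (0 < d)%N.

(* A random bound on the initial potential: only its expectation, of order [K],
   enters the failure probabilities, so the second moment of [x] suffices. *)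
Definition start_bound (K : R) (z : 'cV[R]_d) : R := K * (1 + norm2 z ^+ 2 / d%:R).

Lemma start_bound_gt0 K z : 0 < K -> 0 < start_bound K z.
Proof.
by move=> K0; rewrite mulr_gt0// ltr_pwDl// divr_ge0 ?sqr_ge0 ?ler0n.
Qed.

Lemma measurable_start_bound K : measurable_fun setT (start_bound K).
Proof.
apply: measurable_funM => //; apply: measurable_funD => //.
by apply: measurable_funM => //; exact: measurable_fun_sqr_norm2.
Qed.

(** The orthogonal part is at most [kappa * a i0 * N] with [N = |z|^2]. In the squared bound [d^22]
    splits as [d * d^21]: the hypothesis on the leading coordinate uses up [d^21], and
    [N <= d * (1 + N / d)^2] does the rest. *)
Lemma start_bound_aligned kappa z : 0 < kappa -> (forall j, a j <= kappa * a i0) ->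
  1 <= d%:R ^+ 21 * coord v i0 z ^+ 2 ->
  aligned v a i0 (start_bound (Num.sqrt kappa * d%:R ^+ 11) z) z.
Proof.
move=> k0 a_max c_ge.
have D0 : 0 < d%:R :> R by rewrite ltr0n.
have a0 := a_gt0 i0.
apply/andP; split.
  by apply: contraTneq c_ge => ->; rewrite expr0n mulr0 -ltNge ltr01.
set N := norm2 z ^+ 2.
have N0 : 0 <= N by exact: sqr_ge0.
have h1 : perp_form v a i0 z <= kappa * a i0 * N.
  rewrite /N (sqr_norm2E ortho) (bigD1 i0)//= mulrDr.
  apply: (@le_trans _ _ (\sum_(j | j != i0) kappa * a i0 * coord v j z ^+ 2)).
    by apply: ler_sum => j _; rewrite ler_wpM2r ?sqr_ge0.
  by rewrite -mulr_sumr lerDr mulr_ge0 ?sqr_ge0// mulr_ge0 ?ltW.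
apply: (le_trans h1); rewrite /start_bound -/N.
have -> : (Num.sqrt kappa * d%:R ^+ 11 * (1 + N / d%:R)) ^+ 2 *
    (a i0 * coord v i0 z ^+ 2) =
    kappa * a i0 * (d%:R * (1 + N / d%:R) ^+ 2 * (d%:R ^+ 21 * coord v i0 z ^+ 2)).
  rewrite -[in RHS](@sqr_sqrtr _ kappa) ?(ltW k0)//.
  by ring.
rewrite ler_wpM2l ?mulr_ge0 ?(ltW k0) ?(ltW a0)//.
have h2 : N <= d%:R * (1 + N / d%:R) ^+ 2.
  have -> : d%:R * (1 + N / d%:R) ^+ 2 = d%:R + N * 2 + N ^+ 2 / d%:R.
    by field; rewrite pnatr_eq0 -lt0n.
  have : 0 <= N ^+ 2 / d%:R by rewrite divr_ge0 ?sqr_ge0 ?ltW.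
  lra.
by rewrite (le_trans h2)// ler_peMr// (le_trans N0).
Qed.

Hypothesis gx : standard_gaussian_vector P x.

(** The integrand is affine in [|x|^2], and the mean of [1 + |x|^2 / d] is at most 7, whence
    [14 = 2 * 7]. *)
Lemma integral_start_bound_le K q : 0 < K -> 0 <= q ->
  (\int[P]_w (eps * (100 + 2 * (start_bound K (x w) * q)))%:E <=
   (eps * (100 + 14 * (K * q)))%:E)%E.
Proof.
move=> K0 q0; have D0 : 0 < d%:R :> R by rewrite ltr0n.
have Kq0 : 0 <= K * q by rewrite mulr_ge0// ltW.
pose al := eps * (100 + 2 * (K * q)); pose be := eps * (2 * (K * q)) / d%:R.
have al0 : 0 <= al by rewrite mulr_ge0//; lra.
have be0 : 0 <= be by rewrite divr_ge0 ?(ltW D0)// mulr_ge0// mulr_ge0.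
have mn : measurable_fun setT (fun w => (norm2 (x w) ^+ 2)%:E).
  by apply/measurable_EFinP; exact: measurable_fun_sqr_norm2.
under eq_integral => w _.
  rewrite (_ : eps * _ = al + be * norm2 (x w) ^+ 2); last first.
    by rewrite /al /be /start_bound; field; rewrite pnatr_eq0 -lt0n.
  rewrite EFinD [(be * _)%:E]EFinM; over.
rewrite ge0_integralD//; last 2 first.
- by move=> w _; rewrite -EFinM lee_fin mulr_ge0 ?sqr_ge0.
- exact: measurable_funeM.
rewrite integral_cst//= probability_setT mule1 ge0_integralZl_EFin//; last first.
  by move=> w _; rewrite lee_fin sqr_ge0.
apply: (@le_trans _ _ (al%:E + be%:E * (6 * d%:R)%:E)%E).
  by rewrite leeD2l// lee_wpmul2l ?lee_fin//; exact: gaussian_second_moment.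
rewrite -EFinM -EFinD lee_fin; apply: eqW; rewrite /al /be; field.
by rewrite pnatr_eq0 -lt0n.
Qed.

(** Union bound over the steps, by induction; [56 / 3 = 14 * 4 / 3] comes from summing [14 / 4^t]
    over [t < n]. *)
Lemma iterates_failure_le K n : 0 < K ->
  (P [set w | ~~ aligned v a i0 (start_bound K (x w) / 4 ^+ n) (x_ n w)] <=
   P [set w | ~~ aligned v a i0 (start_bound K (x w)) (x_ 0 w)] +
   (eps * (100 * n%:R + 56 / 3 * K * (1 - (4 ^+ n)^-1)))%:E)%E.
Proof.
move=> K0.
have mg q : measurable_fun setT (fun w => start_bound K (x w) / q).
  apply: measurable_funM => //.
  exact: (measurableT_comp (measurable_start_bound K)).
have mA q t : measurable [set w | aligned v a i0 (start_bound K (x w) / q) (x_ t w)].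
  by apply: measurable_aligned => //; exact: measurable_iterates.
have mN q t : measurable [set w | ~~ aligned v a i0 (start_bound K (x w) / q) (x_ t w)].
  rewrite (_ : [set w | _] =
    ~` [set w | aligned v a i0 (start_bound K (x w) / q) (x_ t w)]).
    exact: measurableC.
  by apply/seteqP; split => w /= /negP.
elim: n => [|n IHn].
  rewrite expr0 invr1 subrr mulr0 mulr0 addr0 mulr0 adde0.
  by under eq_set do rewrite mulr1.
pose B := [set w | aligned v a i0 (start_bound K (x w) / 4 ^+ n) (x_ n w) &&
  ~~ aligned v a i0 (start_bound K (x w) / 4 ^+ n / 4) (x_ n.+1 w)].
have PB : (P B <= (eps * (100 + 14 * (K * (4 ^+ n)^-1)))%:E)%E.
  apply: le_trans (step_failure_le (g := fun z => start_bound K z / 4 ^+ n) n _ _) _.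
  - by apply: measurable_funM => //; exact: measurable_start_bound.
  - by move=> z; rewrite divr_gt0 ?start_bound_gt0// exprn_gt0.
  - by apply: integral_start_bound_le => //; rewrite invr_ge0 exprn_ge0.
have mB : measurable B.
  rewrite (_ : B = [set w | aligned v a i0 (start_bound K (x w) / 4 ^+ n) (x_ n w)] `&`
    [set w | ~~ aligned v a i0 (start_bound K (x w) / (4 ^+ n * 4)) (x_ n.+1 w)]).
    exact: measurableI.
  rewrite /B; under eq_set do rewrite -mulrA -invfM.
  by apply/seteqP; split => w /= /andP.
have sub : [set w | ~~ aligned v a i0 (start_bound K (x w) / 4 ^+ n.+1) (x_ n.+1 w)]
    `<=` [set w | ~~ aligned v a i0 (start_bound K (x w) / 4 ^+ n) (x_ n w)] `|` B.
  move=> w /= nal; case: (boolP (aligned _ _ _ _ (x_ n w))) => al; [right|by left].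
  by rewrite /B /= al /= -mulrA -invfM -exprSr.
apply: le_trans (le_measure P _ _ sub) _; rewrite ?inE//; first exact: measurableU.
apply: le_trans (measureU2 _ _ _) _ => //.
apply: le_trans (leeD IHn PB) _.
rewrite -addeA leeD2l// -EFinD lee_fin; apply: eqW.
by rewrite -natr1 exprSr; field; rewrite expf_neq0.
Qed.

End power_iteration.

(** * Numerical estimates for the iteration count and the failure probability *)

Section numeric_bounds.
Context {R : realType}.
Implicit Types (k D : R) (d : nat).

(** The summand 2 pays for a factor [4 <= expR 2], and the successor rounds up. As [expR 1 <= 4],
    the corresponding power of 4 dominates [4 * k * d^23]. *)
Definition iter_count d k : nat := (Num.truncn (23 * ln d%:R + ln k + 2)).+1.

Lemma ln_nat_ge_half d : (1 < d)%N -> 2^-1 <= ln (d%:R : R).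
Proof.
move=> d1; have h : ln (1 + - 2^-1 : R) <= - 2^-1 by apply: le_ln1Dx; lra.
have e : 1 + - 2^-1 = 2^-1 :> R by field.
rewrite e lnV ?posrE// in h.
apply: (@le_trans _ _ (ln 2)); first by lra.
by rewrite ler_ln ?posrE ?ltr0n ?ler_nat// ltnW.
Qed.

Lemma ln_le_self D : 0 < D -> ln D <= D.
Proof.
move=> D0; have := @le_ln1Dx R (D - 1).
by rewrite subrKC => h; have := h ltac:(lra); lra.
Qed.

(** Rounding up raises the additive constant from 2 to 3, and [3 <= 6 * ln d]; hence
    [29 = 23 + 6]. *)
Lemma iter_count_le d k : (1 < d)%N -> 1 <= k ->
  (iter_count d k)%:R <= 29 * (ln d%:R + ln k).
Proof.
move=> d1 k1; have h := ln_nat_ge_half d1; have k0 := ln_ge0 k1.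
rewrite /iter_count -natr1.
have /truncn_itv/andP[+ _] : 0 <= 23 * ln d%:R + ln k + 2 by lra.
lra.
Qed.

(** From [1/2 <= expR (- 1/2)], by inverting and squaring. *)
Lemma expR1_le4 : expR 1 <= 4 :> R.
Proof.
have h : 2^-1 <= expR (- 2^-1 : R) by have := expR_ge1Dx (- 2^-1 : R); lra.
have e : expR 1 = (expR 2^-1 : R) ^+ 2 by rewrite -expRM_natl; congr expR; field.
rewrite expRN lef_pV2 ?posrE ?expR_gt0// in h.
rewrite e (_ : 4 = 2 ^+ 2); last by ring.
by rewrite ler_sqr ?nnegrE ?expR_ge0.
Qed.

Lemma iter_count_pow d k : (1 < d)%N -> 1 <= k ->
  4 * (k * d%:R ^+ 23) <= 4 ^+ iter_count d k.
Proof.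
move=> d1 k1; have k0 : 0 < k by lra.
have D0 : 0 < d%:R :> R by rewrite ltr0n ltnW.
apply: (@le_trans _ _ (expR 1 ^+ iter_count d k)); last first.
  by rewrite lerXn2r ?nnegrE ?expR_ge0// expR1_le4.
rewrite -expRM_natl mulr1.
apply: (@le_trans _ _ (expR (23 * ln d%:R + ln k + 2))); last first.
  by rewrite ler_expR ltW// truncnS_gt.
rewrite expRD expRD (lnK k0) expRM_natl lnK ?posrE// mulrC.
have -> : expR 2 = (expR 1 : R) ^+ 2 by rewrite -expRM_natl mulr1.
have e2 : 2 <= expR 1 :> R by have := expR_ge1Dx (1 : R); lra.
have e4 : 4 <= (expR 1 : R) ^+ 2.
  by rewrite (_ : 4 = 2 ^+ 2) ?ler_sqr ?nnegrE ?expR_ge0//; ring.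
rewrite [k * _]mulrC ler_wpM2l// mulr_ge0 ?exprn_ge0// ltW//.
Qed.

(** Here [L] is the number of steps and [q] stands for [4^-n]. Bounding logarithms by their
    arguments gives [100 * L <= 5800 * k * D^11]; the geometric part adds at most
    [56 / 3 * k * D^11]. The sum stays below [9000 * k * D^11], where [9000 = 3 * 3000]. *)
Lemma total_failure_le k D L q : 1 <= k -> 2 <= D ->
  L <= 29 * (ln D + ln k) -> 0 <= q ->
  (3000 * k * D ^+ 21)^-1 *
    (100 * L + 56 / 3 * (Num.sqrt k * D ^+ 11) * (1 - q)) <= 3 / D ^+ 10.
Proof.
move=> k1 D2 hL q0.
have D0 : 0 < D by lra.
have k0 : 0 < k by lra.
have D10 : 0 < D ^+ 10 by rewrite exprn_gt0.
have D11 : 0 < D ^+ 11 by rewrite exprn_gt0.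
have D11_ge : D <= D ^+ 11.
  by rewrite -{1}[D]expr1 ler_weXn2l//; lra.
have D11_ge1 : 1 <= D ^+ 11 by rewrite exprn_ege1//; lra.
have sk : Num.sqrt k <= k.
  by rewrite -[leRHS](ger0_norm (ltW k0)) -sqrtr_sqr ler_sqrt ?sqr_ge0// ler_eXnr.
have lD := ln_le_self D0; have lk := ln_le_self k0.
have -> : D ^+ 21 = D ^+ 11 * D ^+ 10 by rewrite -(exprD D 11 10).
have e_gt0 : 0 < 3000 * k * (D ^+ 11 * D ^+ 10).
  apply: mulr_gt0; last exact: mulr_gt0.
  by apply: mulr_gt0; [rewrite ltr0n|].
rewrite mulrC (ler_pdivrMr _ _ e_gt0).
have -> : 3 / D ^+ 10 * (3000 * k * (D ^+ 11 * D ^+ 10)) = 9000 * (k * D ^+ 11).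
  by field; rewrite gt_eqF.
have h1 : D <= k * D ^+ 11 by rewrite (le_trans D11_ge)// ler_peMl// ltW.
have h2 : k <= k * D ^+ 11 by rewrite ler_peMr// ltW.
have h3 : Num.sqrt k * D ^+ 11 * (1 - q) <= k * D ^+ 11.
  apply: (@le_trans _ _ (Num.sqrt k * D ^+ 11)).
    by rewrite ler_piMr ?mulr_ge0 ?sqrtr_ge0 ?(ltW D11)//; lra.
  by rewrite ler_wpM2r// ltW.
rewrite -mulrA; lra.
Qed.

(** The exponent 23 is [11 + 12], from [1 + N / D <= 2 * D^11 <= D^12]. The spare factor 4 suffices
    because [sqrt 10 <= 4]. *)
Lemma final_bound_le k D n N : 1 <= k -> 2 <= D ->
  4 * (k * D ^+ 23) <= 4 ^+ n -> 0 <= N -> N <= D ^+ 12 ->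
  Num.sqrt k * D ^+ 11 * (1 + N / D) / 4 ^+ n <= (Num.sqrt 10)^-1.
Proof.
move=> k1 D2 hn N0 ND.
have D0 : 0 < D by lra.
have k0 : 0 < k by lra.
have D11_ge1 : 1 <= D ^+ 11 by rewrite exprn_ege1//; lra.
have sk : Num.sqrt k <= k.
  by rewrite -[leRHS](ger0_norm (ltW k0)) -sqrtr_sqr ler_sqrt ?sqr_ge0// ler_eXnr.
have s10 : Num.sqrt 10 <= 4 :> R.
  by rewrite -[leRHS]ger0_norm// -sqrtr_sqr ler_sqrt ?sqr_ge0//; lra.
have s0 : 0 < Num.sqrt 10 :> R by rewrite sqrtr_gt0.
apply: (@le_trans _ _ 4^-1); last by rewrite lef_pV2 ?posrE.
rewrite ler_pdivrMr ?exprn_gt0// ler_pdivlMl//.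
apply: le_trans hn; rewrite ler_pM2l//.
have h1 : 1 + N / D <= D * D ^+ 11.
  have : N / D <= D ^+ 11 by rewrite ler_pdivrMr// -(exprSr D 11).
  have : 2 * D ^+ 11 <= D * D ^+ 11 by rewrite ler_wpM2r//; lra.
  lra.
have -> : k * D ^+ 23 = k * D ^+ 11 * (D * D ^+ 11) by ring.
apply: ler_pM => //.
- by rewrite mulr_ge0 ?sqrtr_ge0//; lra.
- by rewrite addr_ge0// divr_ge0// ltW.
- by rewrite ler_wpM2r//; lra.
Qed.

End numeric_bounds.

(** * Convergence of the iteration from a Gaussian start *)

Theorem theorem3p8 (R : realType) :
  exists (C1 C2 : R) (T : nat -> R -> nat),
    [/\ 0 < C1,
        0 < C2,
        forall (d : nat) (k : R), (1 < d)%N -> 1 <= k ->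
          (T d k)%:R <= C1 * (ln d%:R + ln k)
      & forall (d : nat) (hd : (1 < d)%N)
          (Sigma : 'M[R]_d) (eig : 'I_d -> R) (v : 'I_d -> 'cV[R]_d)
          (lambda : R)
          (dS : measure_display) (S : measurableType dS) (mu : probability S R)
          (solve : S -> 'cV[R]_d -> 'cV[R]_d)
          (dO : measure_display) (Omega : measurableType dO)
          (P : probability Omega R)
          (x : Omega -> 'cV[R]_d) (U : nat -> Omega -> S),
          let lambda1 := eig (idx_fst hd) in
          let gap := rel_gap hd eig in
          let B := shifted lambda Sigma in
          let kappa := kappa_inv hd eig lambda in
          symmetric_psd Sigma ->
          orthonormal_eigensystem Sigma eig v ->
          0 < gap ->
          (1 + gap / 150) * lambda1 <= lambda <= (1 + gap / 100) * lambda1 ->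
          measurable_fun setT (fun p : S * 'cV[R]_d => solve p.1 p.2) ->
          (forall y : 'cV[R]_d, norm2 y = 1 ->
             (\int[mu]_s (normB B (solve s y - invmx B *m y))%:E
              <= ((3000 * kappa * d%:R ^+ 21)^-1 *
                  normB B ((lambda - quad_form Sigma y)^-1 *: y
                           - invmx B *m y))%:E)%E) ->
          standard_gaussian_vector P x ->
          fresh_seeds P mu x U ->
          ((1 - C2 / d%:R ^+ 10)%:E <
           P [set w | (potential B (v (idx_fst hd))
                         (solve_iter solve (fun t => U t w) (x w) (T d kappa))
                       <= ((Num.sqrt 10)^-1)%:E)%E])%E].
Proof.
(* Failure has probability at most [11 / d^10]: 2 from the start, 3 from the steps, 6 from a large
   norm of [x]. The constant 12 makes the inequality strict. *)
exists 29, 12, iter_count; split => // [|d hd Sigma eig v lambda dS S mu solve dO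
  Omega P x U lambda1 gap B kappa [_ psd] [eig_nincr ortho eigv] gap0 /andP[l_ge l_le]
  msolve solveP gx fresh]; first exact: iter_count_le.
set i0 := idx_fst hd; pose a j := lambda - eig j.
have eig_ge0 j : 0 <= eig j.
  have := psd (v j).
  by rewrite (quad_form_eigen ortho _ eigv) (bigD1 j)//= big1 ?addr0
    ?(coord_basis ortho) ?eqxx ?expr1n ?mulr1// => k kj;
    rewrite (coord_basis ortho) (negbTE kj) expr0n mulr0.
(* If [lambda1] were [0], the convention [x / 0 = 0] would make the gap zero. *)
have l1_gt0 : 0 < lambda1.
  rewrite lt_neqAle eig_ge0 andbT eq_sym; apply: contraTneq gap0.
  by rewrite /gap /rel_gap -/lambda1 => ->; rewrite invr0 mulr0 ltxx.
have gapE : gap * lambda1 = lambda1 - eig (idx_snd hd).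
  by rewrite /gap /rel_gap -/lambda1 divfK// gt_eqF.
have g1 : 0 < gap * lambda1 by rewrite mulr_gt0.
(* The window for [lambda] puts [a i0] between [gap * lambda1 / 150] and [gap * lambda1 / 100],
   while every other [a j] is at least [gap * lambda1]. *)
have a_i0 : 0 < a i0 /\ 100 * a i0 <= gap * lambda1.
  by rewrite /a -/lambda1; split; lra.
have eig_snd j : j != i0 -> eig j <= eig (idx_snd hd).
  by move=> ji; apply: eig_nincr; rewrite /= lt0n; apply: contra ji => /eqP j0;
    apply/eqP/val_inj.
have a_gap j : j != i0 -> 100 * a i0 <= a j.
  by move=> /eig_snd; rewrite /a -/lambda1 in a_i0 *; lra.
have a_gt0 j : 0 < a j.
  have [->|/a_gap] := eqVneq j i0; first by case: a_i0.
  by case: a_i0; lra.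
have Bv j : B *m v j = a j *: v j.
  by rewrite /B /shifted mulmxBl mul_scalar_mx eigv -scalerBl.
have kappaE : kappa = a (idx_lst hd) / a i0.
  by rewrite /kappa /kappa_inv /eig_inv invrK mulrC.
have a_max j : a j <= kappa * a i0.
  rewrite kappaE divfK ?gt_eqF// /a lerD2l lerN2; apply: eig_nincr.
  by rewrite /= subn1 -ltnS prednK// ltnW.
have kappa1 : 1 <= kappa.
  by have := a_max i0; rewrite -ler_pdivrMr// divff// gt_eqF.
have kappa0 : 0 < kappa by lra.
have D2 : 2 <= d%:R :> R by rewrite ler_nat.
have D0 : 0 < d%:R :> R by lra.
have d_gt0 : (0 < d)%N by exact: ltnW.
pose eps := (3000 * kappa * d%:R ^+ 21)^-1.
have eps0 : 0 <= eps.
  rewrite invr_ge0; apply: mulr_ge0; last by rewrite exprn_ge0// ltW.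
  by apply: mulr_ge0; [rewrite ler0n|exact: ltW].
have solveP' y : norm2 y = 1 ->
  (\int[mu]_s (normB B (solve s y - invmx B *m y))%:E <=
   (eps * normB B ((quad_form B y)^-1 *: y - invmx B *m y))%:E)%E.
  (* For a unit vector the two denominators coincide. *)
  move=> y1; rewrite (_ : quad_form B y = lambda - quad_form Sigma y).
    exact: solveP.
  rewrite (quad_form_eigen ortho _ Bv) (quad_form_eigen ortho _ eigv) /a.
  under eq_bigr do rewrite mulrBl.
  by rewrite sumrB -mulr_sumr -(sqr_norm2E ortho) y1 expr1n mulr1.
have mx := measurable_gaussian gx.
pose K := Num.sqrt kappa * d%:R ^+ 11.
have K0 : 0 < K by rewrite mulr_gt0 ?sqrtr_gt0 ?exprn_gt0.
set n := iter_count d kappa.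
have D10 : 0 < d%:R ^+ 10 :> R by rewrite exprn_gt0.
have sD : 0 < Num.sqrt d%:R :> R by rewrite sqrtr_gt0.
pose bad := [set w | ~~ aligned v a i0 (start_bound K (x w) / 4 ^+ n)
  (solve_iter solve (U ^~ w) (x w) n)].
(* [d^12] is the squared norm up to which [final_bound_le] applies; Markov's inequality with mean at
   most [6 d] leaves a factor [d] to spare. *)
pose far := [set w | d%:R ^+ 12 <= norm2 (x w) ^+ 2].
set good := [set w | (_ <= _)%E].
have goodE : good = [set w | aligned v a i0 ((Num.sqrt 10)^-1)
    (solve_iter solve (U ^~ w) (x w) n)].
  have i10 : 0 <= (Num.sqrt 10 : R)^-1 by rewrite invr_ge0 sqrtr_ge0.
  by apply/seteqP; split => w; rewrite /good /= (potential_le ortho i0 Bv a_gt0).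
have mXn := measurable_iterates msolve mx fresh n.
have mgood : measurable good by rewrite goodE; exact: measurable_aligned.
have mbad : measurable bad.
  rewrite (_ : bad = ~` [set w | aligned v a i0 (start_bound K (x w) / 4 ^+ n)
    (solve_iter solve (U ^~ w) (x w) n)]).
    apply: measurableC; apply: measurable_aligned => //.
    apply: measurable_funM => //.
    exact: (measurableT_comp (measurable_start_bound K)).
  by apply/seteqP; split => w /= /negP.
have mnorm : measurable_fun setT (fun w => norm2 (x w) ^+ 2).
  exact: measurable_fun_sqr_norm2.
have mfar : measurable far.
  rewrite -[X in measurable X]setTI.
  exact: (measurable_fun_ler (f := cst (d%:R ^+ 12)) (g := fun w => norm2 (x w) ^+ 2)).
have bad_cover : ~` good `<=` bad `|` far.
  rewrite goodE => w /= ngood.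
  have [|Nlt] := leP (d%:R ^+ 12) (norm2 (x w) ^+ 2); [by right|left].
  apply/negP => al; apply: ngood; apply: (aligned_le a_gt0 _ _ al).
    by rewrite divr_ge0 ?exprn_ge0// ltW// start_bound_gt0.
  apply: final_bound_le => //; [exact: iter_count_pow|exact: sqr_ge0|exact: ltW].
have Pfar : (P far <= (6 / d%:R ^+ 10)%:E)%E.
  have D12 : 0 < d%:R ^+ 12 :> R by rewrite exprn_gt0.
  rewrite -(@lee_pmul2l _ (d%:R ^+ 12)%:E)//.
  apply: le_trans (ge0_markov P mnorm _ D12) _; first by move=> w; exact: sqr_ge0.
  apply: le_trans (gaussian_second_moment gx) _.
  rewrite -EFinM lee_fin (_ : d%:R ^+ 12 * _ = 6 * (d%:R * d%:R)).
    by rewrite ler_pM2l// ler_peMl; lra.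
  by field; rewrite gt_eqF.
have Pstart : (P [set w | ~~ aligned v a i0 (start_bound K (x w))
    (solve_iter solve (U ^~ w) (x w) 0)] <= (2 / d%:R ^+ 10)%:E)%E.
  (* Chosen so that [r^2 = d^-21], matching [start_bound_aligned], and so that anticoncentration
     costs [2 * r * sqrt d = 2 / d^10]. *)
  pose r := (d%:R ^+ 10 * Num.sqrt d%:R : R)^-1.
  have r0 : 0 <= r by rewrite invr_ge0 mulr_ge0 ?ltW.
  apply: (@le_trans _ _ (P [set w | (`|((v i0)^T *m x w) 0 0| < r)%R])).
    apply: le_measure; rewrite ?inE.
    - rewrite (_ : [set w | _] = ~` [set w | aligned v a i0 (start_bound K (x w))
        (solve_iter solve (U ^~ w) (x w) 0)]).
        apply: measurableC; apply: measurable_aligned.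
          exact: (measurableT_comp (measurable_start_bound K)).
        exact: (measurable_iterates msolve mx fresh 0).
      by apply/seteqP; split => w /= /negP.
    - rewrite -[X in measurable X]setTI.
      apply: (measurable_fun_ltr (f := fun w => `|coord v i0 (x w)|) (g := cst r)) => //.
      apply: measurableT_comp => //; under eq_fun do rewrite coordE.
      apply: measurable_sum => k; apply: measurable_funM => //.
      exact: measurable_fun_cV_coord.
    - move=> w /= nal; rewrite ltNge; apply: contra nal => rc.
      apply: (aligned_normalize ortho); apply: start_bound_aligned => //.
      have : r ^+ 2 <= coord v i0 (x w) ^+ 2.
        by rewrite -[leRHS]real_normK ?num_real// lerXn2r ?nnegrE.
      rewrite /r exprVn exprMn sqr_sqrtr ?(ltW D0)// -(exprM d%:R 10 2) -(exprSr d%:R 20).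
      by rewrite -[_^-1]mul1r ler_pdivrMr ?exprn_gt0// mulrC.
  apply: le_trans (gaussian_anticoncentration gx (norm2_eigen ortho i0) r0) _.
  by rewrite lee_fin; apply: eqW; rewrite /r; field; rewrite !gt_eqF.
have Pbad : (P bad <= (5 / d%:R ^+ 10)%:E)%E.
  have := iterates_failure_le ortho Bv a_gt0 a_gap msolve eps0 solveP' mx fresh
    d_gt0 gx n K0.
  move=> /le_trans; apply.
  apply: le_trans (leeD2r _ Pstart) _; rewrite -EFinD lee_fin.
  have : eps * (100 * n%:R + 56 / 3 * K * (1 - (4 ^+ n)^-1)) <= 3 / d%:R ^+ 10.
    by apply: total_failure_le => //; exact: iter_count_le.
  rewrite -(lerD2l (2 / d%:R ^+ 10)) => /le_trans; apply; apply: eqW.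
  by field; rewrite gt_eqF.
have Pfail : (P (~` good) <= (11 / d%:R ^+ 10)%:E)%E.
  apply: le_trans (le_measure P _ _ bad_cover) _; rewrite ?inE;
    [exact: measurableC|exact: measurableU|].
  apply: le_trans (measureU2 _ mbad mfar) _.
  apply: le_trans (leeD Pbad Pfar) _; rewrite -EFinD lee_fin; apply: eqW.
  by field; rewrite gt_eqF.
have fP : P good \is a fin_num by exact: fin_num_measure.
move: Pfail; rewrite probability_setC// -(fineK fP) -EFinB lee_fin lte_fin.
have : 11 / d%:R ^+ 10 < 12 / d%:R ^+ 10 :> R by rewrite ltr_pM2r ?invr_gt0//; lra.
by move: (fine _) (11 / _) (12 / _) => p q s; lra.
Qed.
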